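(* Let $L:[0,T]\times\mathbb{R}^N\times\mathbb{R}^N\to\mathbb{R}\cup\{\pm\infty\}$ satisfy (L1)–(L4), and let $U:[0,T]\times\mathbb{R}^N\to\mathbb{R}\cup\{\pm\infty\}$ be proper and lower semicontinuous and satisfy: for every $(t,x,u)\in\mathrm{epi}\,U\cap[0,T)\times\mathbb{R}^N\times\mathbb{R}$ and every $(n^t,n^x,n^u)\in N_{\mathrm{epi}\,U}(t,x,u)$ there exist sequences $(t_k,x_k)\to(t,x)$, $\alpha_k\to0$ and $v_k\in\mathrm{dom}\,L(t_k,x_k,\cdot)$ such that $n^t+\langle v_k,n^x\rangle-n^uL(t_k,x_k,v_k)\leq\alpha_k$ for all $k\in\mathbb{N}$. Then for every $(t_0,x_0,u_0)\in\mathrm{epi}\,U\cap[0,T)\times\mathbb{R}^N\times\mathbb{R}$ there exist $T_0\in(t_0,T)$ and an absolutely continuous $(x,u):[t_0,T_0]\to\mathbb{R}^N\times\mathbb{R}$ with $(x,u)(t_0)=(x_0,u_0)$, $(\dot x(t),\dot u(t))\in Q(t,x(t))$ for a.e. $t\in[t_0,T_0]$, and $u(t)\geq U(t,x(t))$ for all $t\in[t_0,T_0]$.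
   Context: $\mathbb{B}_R$ is the closed ball of radius $R$ at $0$. For a function $\varphi$, $\mathrm{dom}\,\varphi=\{z:\varphi(z)\neq\pm\infty\}$, $\mathrm{epi}\,\varphi=\{(z,r):\varphi(z)\leq r\}$; $\varphi$ is proper if it never equals $-\infty$ and is not identically $+\infty$. $U$ is regarded as $+\infty$ outside $[0,T]\times\mathbb{R}^N$. For $E\subset\mathbb{R}^M$, $w\in E$: tangent cone $T_E(w)=\{\zeta:\liminf_{\tau\to0^+}\mathrm{dist}(w+\tau\zeta,E)/\tau=0\}$, normal cone $N_E(w)=\{\xi:\langle\zeta,\xi\rangle\leq0\ \forall\zeta\in T_E(w)\}$. $Q(t,x):=\{(v,\eta)\in\mathbb{R}^N\times\mathbb{R}: L(t,x,v)\leq-\eta\}$. (L1) $L$ is lower semicontinuous in all variables. (L2) $L(t,x,\cdot)$ is convex and proper for every $t,x$. (L3) for every $(t,x,v)$ and every $(t_n,x_n)\to(t,x)$ there exist $v_n\to v$ with $L(t_n,x_n,v_n)\to L(t,x,v)$. (L4) for every $R\geq0$ there is $C_R\geq0$ with $L(t,x,v)=+\infty$ whenever $t\in[0,T]$, $x\in\mathbb{B}_R$, $|v|>C_R$. *)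

(* Defs.v *)
From HB Require Import structures.
From mathcomp Require Import all_boot all_order all_algebra.
From mathcomp Require Import all_classical all_reals all_analysis.
Set Implicit Arguments. Unset Strict Implicit. Unset Printing Implicit Defensive.
Import Order.TTheory GRing.Theory Num.Theory.
Import numFieldNormedType.Exports.
Local Open Scope ring_scope.
Local Open Scope classical_set_scope.

Section Defs.
Variable R : realType.
Variable N : nat.

Definition dotv (x y : 'rV[R]_N) : R := \sum_(i < N) x 0 i * y 0 i.
Definition enorm (x : 'rV[R]_N) : R := Num.sqrt (dotv x x).

Definition pt := (R * 'rV[R]_N * R)%type.
Definition pt_add (p q : pt) : pt := (p.1.1 + q.1.1, p.1.2 + q.1.2, p.2 + q.2).
Definition pt_sub (p q : pt) : pt := (p.1.1 - q.1.1, p.1.2 - q.1.2, p.2 - q.2).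
Definition pt_scale (a : R) (p : pt) : pt := (a * p.1.1, a *: p.1.2, a * p.2).
Definition pt_dot (p q : pt) : R := p.1.1 * q.1.1 + dotv p.1.2 q.1.2 + p.2 * q.2.
Definition pt_norm (p : pt) : R := Num.sqrt (pt_dot p p).

(* Bouligand tangent cone: liminf_{tau -> 0+} dist(w + tau zeta, E)/tau = 0.
   Since dist >= 0, this liminf is 0 iff for all eps, delta > 0 there is
   tau in (0, delta) with dist(w + tau zeta, E) < eps * tau, i.e. some e in E
   with |w + tau zeta - e| < eps * tau. *)
Definition tangent_cone (E : set pt) (w : pt) : set pt :=
  [set zeta | forall eps delta : R, 0 < eps -> 0 < delta ->
     exists tau : R, [/\ 0 < tau, tau < delta &
       exists2 e, E e & pt_norm (pt_sub (pt_add w (pt_scale tau zeta)) e) < eps * tau]].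

Definition normal_cone (E : set pt) (w : pt) : set pt :=
  [set xi | forall zeta, tangent_cone E w zeta -> pt_dot zeta xi <= 0].

Definition Uext (T : R) (U : R -> 'rV[R]_N -> \bar R) (t : R) (x : 'rV[R]_N) : \bar R :=
  if t \in `[0, T] then U t x else +oo%E.

Definition epi (T : R) (U : R -> 'rV[R]_N -> \bar R) : set pt :=
  [set p | (Uext T U p.1.1 p.1.2 <= p.2%:E)%E].

Definition lsc2 (f : R -> 'rV[R]_N -> \bar R) : Prop :=
  forall t x (r : R), (r%:E < f t x)%E -> exists2 d : R, 0 < d &
    forall t' x', `|t' - t| < d -> enorm (x' - x) < d -> (r%:E < f t' x')%E.

Definition proper2 (T : R) (U : R -> 'rV[R]_N -> \bar R) : Prop :=
  (forall t x, t \in `[0, T] -> U t x != -oo%E) /\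
  (exists t x, t \in `[0, T] /\ U t x != +oo%E).

Definition L1 (T : R) (L : R -> 'rV[R]_N -> 'rV[R]_N -> \bar R) : Prop :=
  forall t x v (r : R), t \in `[0, T] -> (r%:E < L t x v)%E ->
    exists2 d : R, 0 < d & forall t' x' v', t' \in `[0, T] ->
      `|t' - t| < d -> enorm (x' - x) < d -> enorm (v' - v) < d ->
      (r%:E < L t' x' v')%E.

Definition L2 (T : R) (L : R -> 'rV[R]_N -> 'rV[R]_N -> \bar R) : Prop :=
  forall t x, t \in `[0, T] ->
    [/\ (* convex: the epigraph of L(t,x,.) is convex *)
        (forall v w (a b lam : R), 0 <= lam <= 1 ->
           (L t x v <= a%:E)%E -> (L t x w <= b%:E)%E ->
           (L t x (lam *: v + (1 - lam) *: w)%R <= (lam * a + (1 - lam) * b)%:E)%E),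
        (forall v, L t x v != -oo%E) &
        (exists v, L t x v != +oo%E)].

Definition L3 (T : R) (L : R -> 'rV[R]_N -> 'rV[R]_N -> \bar R) : Prop :=
  forall t x v (tn : R^nat) (xn : nat -> 'rV[R]_N),
    t \in `[0, T] -> (forall n, tn n \in `[0, T]) ->
    tn @ \oo --> t -> xn @ \oo --> x ->
    exists vn : nat -> 'rV[R]_N,
      vn @ \oo --> v /\ (fun n => L (tn n) (xn n) (vn n)) @ \oo --> L t x v.

Definition L4 (T : R) (L : R -> 'rV[R]_N -> 'rV[R]_N -> \bar R) : Prop :=
  forall Rad : R, 0 <= Rad -> exists2 C : R, 0 <= C &
    forall t x v, t \in `[0, T] -> enorm x <= Rad -> C < enorm v -> L t x v = +oo%E.

Definition Qset (L : R -> 'rV[R]_N -> 'rV[R]_N -> \bar R) (t : R) (x : 'rV[R]_N)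
  : set ('rV[R]_N * R) :=
  [set p | (L t x p.1 <= (- p.2)%:E)%E].

Definition abs_cont_on (a b : R) (x : R -> 'rV[R]_N) (u : R -> R) : Prop :=
  forall eps : R, 0 < eps -> exists2 delta : R, 0 < delta &
    forall (n : nat) (s e : 'I_n -> R),
      (forall i, a <= s i /\ s i <= e i /\ e i <= b) ->
      (forall i j, i != j -> e i <= s j \/ e j <= s i) ->
      \sum_(i < n) (e i - s i) < delta ->
      \sum_(i < n) Num.sqrt (dotv (x (e i) - x (s i)) (x (e i) - x (s i))
                             + (u (e i) - u (s i)) ^+ 2) < eps.

End Defs.

(* Main.v *)
(* K := epi U is closed, and for y with nearest point w in K the
   vector y - w is normal to K at w with nonpositive last component.  The
   hypothesis thus yields (t', x', v) near w such that the Euler step in direction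
   (1, v, - min (L t' x' v) kappa) increases dist (y, K)^2 by at most
   2 h eps + h^2 c^2 ("proximal aiming"); truncating L at level kappa bounds
   the slope.  Iterating gives polygons that stay close to K.

   Limits of the polygons are taken pointwise along an ultrafilter, which replaces
   Ascoli and Helly.  The limit x is Lipschitz, but the limit u of the last
   component need not be absolutely continuous.  So for every level m one also
   takes the limit w m of the Euler sums of M + min L m, where - M bounds L below:
   it is Lipschitz, nondecreasing, increasing in m, and bounded by
   M (t - t0) + u0 - u t.  Lipschitz functions are integrals of their derivatives
   (Radon-Nikodym), so by monotone convergence sup_m (w m) is an absolutely
   continuous W with W' >= (w m)' almost everywhere, and
   u0 + M (t - t0) - W t >= u t >= U t (x t).

   Finally, an affine function lying strictly below L t (x t) on the relevant ball
   stays below L at nearby (t', x') by lower semicontinuity, so averaging the Euler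
   velocities gives a + <b, x'> <= (w m)' - M for m large; L t (x t) is the supremum
   of its affine minorants, hence L t (x t) x' <= W' - M. *)

Require Import Defs.
From HB Require Import structures.
From mathcomp Require Import all_boot all_order all_algebra.
From mathcomp Require Import all_classical all_reals all_analysis.
From mathcomp Require Import measurable_realfun lra ring.
Set Implicit Arguments. Unset Strict Implicit. Unset Printing Implicit Defensive.
Import Order.TTheory GRing.Theory Num.Theory.
Import numFieldNormedType.Exports.
Local Open Scope ring_scope.
Local Open Scope classical_set_scope.

(** * Densities of Lipschitz functions and monotone limits of their primitives *)

Section LipschitzMonotone.
Context {R : realType}.
Implicit Types (f g : R -> R) (a b c : R).
Notation mu := (@lebesgue_measure R).

Definition lipR (c : R) f := forall s t, `|f t - f s| <= c * `|t - s|.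

Lemma lipR_continuous c f : lipR c f -> continuous f.
Proof.
move=> lf x; apply/cvgrPdist_lt => e e0.
near=> y; rewrite distrC (le_lt_trans (lf x y))//.
have c0 : 0 < `|c| + 1 by rewrite ltr_wpDl.
apply: (@le_lt_trans _ _ ((`|c| + 1) * `|y - x|)).
  by rewrite ler_wpM2r// (le_trans (ler_norm c))// lerDl.
rewrite -ltr_pdivlMl// distrC; near: y.
apply/nbhs_ballP; exists ((`|c| + 1)^-1 * e) => //=.
by rewrite mulr_gt0// invr_gt0.
Unshelve. all: by end_near. Qed.

Lemma stieltjes_ocitv (F : cumulative R R) a b : a <= b ->
  lebesgue_stieltjes_measure F `]a, b]%classic = (F b - F a)%:E.
Proof.
move=> ab; rewrite /lebesgue_stieltjes_measure/= /measure_extension measurable_mu_extE/=; last exact: is_ocitv.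
by rewrite wlength_itv_bnd.
Qed.

(* [stieltjes f] and [stieltjes (c t - f)] add up to [c * lebesgue]. *)
Lemma stieltjes_le (F G : cumulative R R) c : 0 <= c ->
  (forall t, F t + G t = c * t) ->
  forall A, measurable A -> (lebesgue_stieltjes_measure F A <= c%:E * mu A)%E.
Proof.
move=> c0 FG A mA.
pose H : R -> R := fun t => c * t.
have Hnd : nondecreasing H by move=> s t st; rewrite /H ler_wpM2l.
have Hrc : right_continuous H.
  by apply: right_continuousW => x; apply: cvgM; [exact: cvg_cst|exact: cvg_id].
pose Hc : cumulative R R := HB.pack H (isCumulative.Build R _ R H Hnd Hrc).
pose cn : {nonneg R} := NngNum c0.
have E1 : lebesgue_stieltjes_measure Hc A = mscale cn mu A.
  apply: lebesgue_stieltjes_measure_unique => // X [[x y] _ <-]/=.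
  have [xy|yx] := leP x y; last first.
    by rewrite set_itv_ge ?measure0// bnd_simp -leNgt ltW.
  rewrite stieltjes_ocitv// /mscale/= -[lebesgue_measure]/(lebesgue_stieltjes_measure idfun).
  by rewrite stieltjes_ocitv// -EFinM /= /H mulrBr.
have E2 : lebesgue_stieltjes_measure Hc A =
    measure_add (lebesgue_stieltjes_measure F) (lebesgue_stieltjes_measure G) A.
  apply: lebesgue_stieltjes_measure_unique; last by [].
  move=> X [[x y] _ <-]; cbn [fst snd].
  have [xy|yx] := leP x y; last first.
    by rewrite set_itv_ge ?measure0// bnd_simp -leNgt ltW.
  rewrite /= /msum !big_ord_recl big_ord0 adde0 /= !stieltjes_ocitv// -EFinD /= /H -!FG; congr (_%:E); lra.
rewrite -[leRHS]/(mscale cn mu A) -E1 E2 measure_addE.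
exact: leeDl.
Qed.

(** The Stieltjes measure of [f] is at most [c] times Lebesgue measure, because [c t - f t] is
    nondecreasing too; Radon-Nikodym then provides the density. *)
Lemma nondecreasing_lipschitz_density f c a b : a < b -> 0 <= c ->
  {homo f : s t / s <= t} -> lipR c f ->
  exists g : R -> R, [/\ forall t, 0 <= g t, mu.-integrable setT (EFin \o g) &
    forall t, a <= t <= b -> f t - f a = \int[mu]_(s in `]-oo, t]) g s].
Proof.
move=> ab c0 ndf lf.
have rcf : right_continuous f by apply/right_continuousW/lipR_continuous/lf.
pose F : cumulative R R := HB.pack f (isCumulative.Build R _ R f ndf rcf).
pose g0 : R -> R := fun t => c * t - f t.
have ndg : nondecreasing g0.
  move=> s t st; rewrite /g0; have := lf s t.
  rewrite !ger0_norm ?subr_ge0 ?ndf//; lra.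
have rcg : right_continuous g0.
  apply: right_continuousW => x; apply: cvgB; last exact: (lipR_continuous lf).
  by apply: cvgM; [exact: cvg_cst|exact: cvg_id].
pose G : cumulative R R := HB.pack g0 (isCumulative.Build R _ R g0 ndg rcg).
have Fle := @stieltjes_le F G c c0 _.
have {}Fle A : measurable A -> (lebesgue_stieltjes_measure F A <= c%:E * mu A)%E.
  by apply: Fle => t; rewrite /= /g0; lra.
have mab : measurable (`]a, b]%classic : set (measurableTypeR R)) by exact: measurable_itv.
have finab : (lebesgue_stieltjes_measure F `]a, b]%classic < +oo)%E.
  by rewrite stieltjes_ocitv ?ltry// ltW.
(* Cutting down to []a, b]] makes the measure finite and lets the integrals start at [-oo]. *)
pose nu : {finite_measure set (measurableTypeR R) -> \bar R} := mfrestr mab finab.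
have numu : nu `<< mu.
  apply/null_content_dominatesP => A mA A0.
  rewrite /nu/= /mfrestr/= /mrestr.
  apply/eqP; rewrite eq_le measure_ge0 andbT.
  have mAab : measurable (A `&` `]a, b]%classic) by apply: measurableI.
  apply: (le_trans (Fle _ mAab)).
  have -> : mu (A `&` `]a, b]%classic) = 0.
    by apply: (subset_measure0 mAab mA) => //; exact: subIsetl.
  by rewrite mule0.
have [h [h0 hfin hint hE]] := radon_nikodym_sigma_finite numu.
exists (fine \o h); split.
- by move=> t /=; rewrite fine_ge0.
- apply: (eq_integrable _ _ _ _ hint) => // x _ /=.
  by rewrite fineK.
- move=> t /andP[at_ tb].
  rewrite /Rintegral; have -> : (\int[mu]_(s in `]-oo, t]) ((fine \o h) s)%:E = \int[mu]_(s in `]-oo, t]) h s)%E.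
    by apply: eq_integral => s _ /=; rewrite fineK.
  rewrite -hE; last exact: measurable_itv.
  rewrite /nu/= /mfrestr/= /mrestr.
  have -> : `]-oo, t]%classic `&` `]a, b]%classic = `]a, t]%classic :> set R.
    apply/seteqP; split => s /=; rewrite !in_itv/=; first by case=> -> /andP[->].
    by move=> /andP[as_ st]; rewrite st as_/= (le_trans st).
  by rewrite stieltjes_ocitv.
Qed.


(** Lebesgue differentiation of the primitive of [g]. The formula for [f] is known on [[a, b]] only,
    so [t] has to be interior for [f] to agree with [f a] plus the primitive near [t]. *)
Lemma density_derivable f g a b : mu.-integrable setT (EFin \o g) ->
  (forall t, a <= t <= b -> f t - f a = \int[mu]_(s in `]-oo, t]) g s) ->
  {ae mu, forall t, a < t < b -> derivable f t 1 /\ 'D_1 f t = g t}.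
Proof.
move=> ig fE.
have ig' y : mu.-integrable `]-oo, y] (EFin \o g).
  by apply: integrableS ig => //; exact: measurable_itv.
have lg : locally_integrable [set: R] g.
  by apply: open_integrable_locally => //; exact: openT.
have := FTC1Ny ig' lg; apply: filterS; first exact: (ae_filter_ringOfSetsType mu).
move=> t [dF FE] /andP[at_ tb].
pose F := (fun x => \int[mu]_(s in `]-oo, x]) g s) : R -> R.
have nearF : \forall x \near t, (cst (f a) \+ F) x = f x.
  near=> x; rewrite /F /= -fE; first lra.
  apply/andP; split; apply: ltW.
    by near: x; exact: lt_nbhsr.
  by near: x; exact: lt_nbhsl.
have dc : derivable (cst (f a) : R -> R) t 1 by exact: derivable_cst.
have dF' : derivable (cst (f a) \+ F) t 1 by exact: (derivableD dc dF).
split; first exact: (near_eq_derivable nearF dF').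
rewrite -(near_eq_derive _ nearF) (deriveD dc dF) derive_cst add0r -derive1E.
exact: FE.
Unshelve. all: by end_near. Qed.

(** [f t + c t] is nondecreasing and Lipschitz, hence has a density and is differentiable almost
    everywhere; [c t] is then subtracted. *)
Lemma lipschitz_ae_derivable f c a b : a < b -> 0 <= c -> lipR c f ->
  {ae mu, forall t, a < t < b -> derivable f t 1}.
Proof.
move=> ab c0 lf; pose h t := f t + c * t.
have ndh : {homo h : s t / s <= t}.
  move=> s t st; rewrite /h; have := lf s t.
  rewrite (ger0_norm (_ : 0 <= t - s)) ?subr_ge0// ler_norml => /andP[+ _]; lra.
have lh : lipR (c + c) h.
  move=> s t; rewrite /h (_ : _ - _ = (f t - f s) + c * (t - s)); last ring.
  by rewrite (le_trans (ler_normD _ _))// mulrDl lerD// normrM ger0_norm.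
have [g [g0 ig gE]] := nondecreasing_lipschitz_density ab (addr_ge0 c0 c0) ndh lh.
have := density_derivable ig gE; apply: filterS; first exact: (ae_filter_ringOfSetsType mu).
move=> t H /H[dh _].
have -> : f = h - (fun t => c * t).
  by apply/funext => s; rewrite /h fctE/= addrK.
apply: derivableB => //; apply: derivableM => //.
Qed.

(** The sum is at most the integral of [|g|] over the union of the disjoint intervals []s i, e i]],
    which is small once the union has small measure. *)
Lemma integral_abs_cont g : mu.-integrable setT (EFin \o g) ->
  let W t := \int[mu]_(s in `]-oo, t]) g s in
  forall eps : R, 0 < eps -> exists2 delta, 0 < delta &
    forall n (s e : 'I_n -> R), (forall i, s i <= e i) ->
      (forall i j, i != j -> e i <= s j \/ e j <= s i) ->
      \sum_(i < n) (e i - s i) < delta ->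
      \sum_(i < n) `|W (e i) - W (s i)| < eps.
Proof.
move=> ig W eps eps0.
have [d [d0 dP]] := integral_normr_continuous ig eps0.
exists d => // n s e se dis sd.
pose F (i : 'I_n) : set R := `]s i, e i]%classic.
have mF i : measurable (F i) by exact: measurable_itv.
have tF : trivIset setT F.
  apply/trivIsetP => i j _ _ ij; apply/seteqP; split => // x [] /=.
  rewrite /F/= !in_itv/= => /andP[si xe] /andP[sj xe'].
  by case: (dis _ _ ij) => h; lra.
have tF' : trivIset [set` index_enum 'I_n] F by apply: sub_trivIset tF.
pose A := \big[setU/set0]_(i < n) F i.
have mA : measurable A by apply: bigsetU_measurable.
have ig' B : measurable B -> mu.-integrable B (EFin \o g).
  by move=> mB; apply: integrableS ig.
have ign B : measurable B -> mu.-integrable B (EFin \o (fun x => `|g x|)).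
  by move=> mB; apply: (integrable_norm (ig' _ mB)).
have muA : (mu A < d%:E)%E.
  rewrite /A measure_bigsetU_ord//=.
  under eq_bigr => i _.
    have -> : mu (F i) = (e i - s i)%:E.
      rewrite /F lebesgue_measure_itv/= lte_fin.
      case: ltP => // es; have -> : e i = s i by apply/eqP; rewrite eq_le es se.
      by rewrite subrr.
    over.
  by rewrite sumEFin lte_fin.
apply: le_lt_trans (dP _ mA muA).
have -> : \int[mu]_(x in A) `|g x| = \sum_(i < n) \int[mu]_(x in F i) `|g x|.
  rewrite /Rintegral [X in fine X]integral_bigsetU_EFin//=.
  - rewrite -sum_fine// => i _; apply: integrable_fin_num; [exact: mF|exact: (ign _ (mF i))].
  - exact: index_enum_uniq.
  - by apply: (measurable_int mu); exact: ign.
apply: ler_sum => i _.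
have -> : W (e i) - W (s i) = \int[mu]_(x in F i) g x.
  apply: (@Rintegral_itvB _ g -oo%O (BRight (e i)) (s i)) => //.
    by apply: ig'; exact: measurable_itv.
  by rewrite bnd_simp.
by apply: le_normr_Rintegral; [exact: mF|exact: (ig' _ (mF i))].
Qed.

(** [w m] is a telescoping sum of differences with nonnegative densities. The bound [B b] and
    monotone convergence make the series of densities integrable up to [b], and [W] is its
    primitive; almost everywhere the derivative of [w m] is a partial sum of that series. *)
Lemma monotone_lipschitz_limit (w : nat -> R -> R) (c : nat -> R) (B : R -> R) a b :
  a < b -> (forall m, 0 <= c m) -> (forall m, lipR (c m) (w m)) ->
  {homo w 0%N : s t / s <= t} ->
  (forall m, {homo (fun t => w m.+1 t - w m t) : s t / s <= t}) ->
  (forall m, w m a = 0) ->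
  (forall m t, a <= t <= b -> w m t <= B t) ->
  exists W : R -> R, [/\ W a = 0, forall t, a <= t <= b -> W t <= B t,
    forall eps : R, 0 < eps -> exists2 delta, 0 < delta &
    forall n (s e : 'I_n -> R), (forall i, s i <= e i) ->
      (forall i j, i != j -> e i <= s j \/ e j <= s i) ->
      \sum_(i < n) (e i - s i) < delta ->
      \sum_(i < n) `|W (e i) - W (s i)| < eps &
    {ae mu, forall t, a < t < b -> derivable W t 1 /\
       forall m, derivable (w m) t 1 /\ 'D_1 (w m) t <= 'D_1 W t}].
Proof.
move=> ab c0 lw nd0 ndS wa wB.
pose d m := if m is k.+1 then (fun t => w k.+1 t - w k t) else w 0%N.
pose cd m := if m is k.+1 then c k.+1 + c k else c 0%N.
have dens m : exists g : R -> R, [/\ forall t, 0 <= g t, mu.-integrable setT (EFin \o g) &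
    forall t, a <= t <= b -> d m t - d m a = \int[mu]_(s in `]-oo, t]) g s].
  apply: (@nondecreasing_lipschitz_density _ (cd m)) => //.
  - by case: m => [|m] /=; rewrite ?addr_ge0.
  - by case: m.
  - case: m => [|m] //= s t.
    have -> : w m.+1 t - w m t - (w m.+1 s - w m s) =
      (w m.+1 t - w m.+1 s) - (w m t - w m s) by lra.
    rewrite (le_trans (ler_normB _ _))// mulrDl lerD//; exact: lw.
have [g gP] := choice dens.
have g0 m t : 0 <= g m t by have [] := gP m.
have ig m : mu.-integrable setT (EFin \o g m) by have [] := gP m.
have gE m t : a <= t <= b -> d m t = \int[mu]_(s in `]-oo, t]) g m s.
  move=> tab; have [_ _ <- //] := gP m.
  by case: m {tab} => [|m] /=; rewrite !wa ?subrr subr0.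
have sumd m t : \sum_(0 <= i < m.+1) d i t = w m t.
  elim: m => [|m ih]; first by rewrite big_nat1.
  by rewrite big_nat_recr//= ih; lra.
pose G (t : R) : \bar R := (\sum_(n <oo) (g n t)%:E)%E.
have mg m : measurable_fun [set: measurableTypeR R] (EFin \o g m : R -> \bar R) by exact: (measurable_int mu).
have mG : measurable_fun [set: measurableTypeR R] (G : R -> \bar R).
  apply: (ge0_emeasurable_sum (h := fun n => EFin \o g n) (P := xpredT)).
    by move=> k x _ _; rewrite lee_fin.
  by move=> k _; exact: mg.
have G0 t : (0 <= G t)%E by apply: nneseries_ge0 => n _ _; rewrite lee_fin.
have intG t : a <= t <= b -> (\int[mu]_(s in `]-oo, t]) G s <= (B t)%:E)%E.
  move=> tab; rewrite integral_nneseries//; last 2 first.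
  - by move=> n; apply: measurable_funTS; exact: mg.
  - by move=> n x _; rewrite lee_fin.
  apply: lime_le.
    by apply: is_cvg_nneseries => n _ _; apply: integral_ge0 => x _; rewrite lee_fin.
  near=> n.
  have dE i : (\int[mu]_(x in `]-oo, t]) (g i x)%:E = (d i t)%:E)%E.
    rewrite gE// /Rintegral fineK//; apply: integrable_fin_num => //.
    by apply: integrableS (ig i) => //; exact: measurable_itv.
  under eq_bigr do rewrite dE.
  have -> : n = n.-1.+1 by rewrite prednK//; near: n; exists 1%N.
  by rewrite sumEFin lee_fin sumd wB.
pose A : set R := `]-oo, b]%classic.
have mA : measurable (A : set (measurableTypeR R)) by exact: measurable_itv.
have iG : mu.-integrable A G.
  apply/integrableP; split; first by apply: measurable_funTS; exact: mG.
  have -> : (\int[mu]_(x in A) `|G x| = \int[mu]_(x in A) G x)%E.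
    by apply: eq_integral => x _; rewrite gee0_abs.
  have := intG b; rewrite lexx ltW// => /(_ isT) /le_lt_trans; apply; exact: ltry.
pose h : R -> R := (fine \o G) \_ A.
have ih : mu.-integrable setT (EFin \o h).
  rewrite /h -restrict_EFin; apply/integrable_restrict => //.
  rewrite setTI; apply/integrableP; split.
    by apply/measurable_EFinP/measurable_funTS; apply: measurableT_comp mG.
  move/integrableP: iG => [_]; apply: le_lt_trans.
  apply: ge0_le_integral => //=.
  - by do 2 apply: measurableT_comp => //; apply: measurable_funTS; apply: measurableT_comp mG.
  - by apply: measurableT_comp => //; apply: measurable_funTS; exact: mG.
  - by move=> x _; case: (G x) => [r| |]; rewrite /= ?normr0 ?leey.
pose W t := \int[mu]_(s in `]-oo, t]) h s.
have Wle t : a <= t <= b -> 0 <= W t /\ ((W t)%:E <= \int[mu]_(s in `]-oo, t]) G s)%E.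
  move=> /andP[at_ tb]; split.
    apply: Rintegral_ge0 => y _; rewrite /h patchE; case: ifP => // _.
    exact: fine_ge0.
  rewrite /W /Rintegral fineK; last first.
    apply: integrable_fin_num => //; apply: integrableS ih => //; exact: measurable_itv.
  apply: ge0_le_integral => //.
  - by move=> x _; rewrite lee_fin /h patchE; case: ifP => // _; exact: fine_ge0.
  - apply: measurable_funTS; exact: (measurable_int mu).
  - by apply: measurable_funTS; exact: mG.
  - move=> x _; rewrite /h patchE; case: ifP => // _ /=.
    by have := G0 x; case: (G x) => [r| |]//= _; exact: leey.
(* Each density has mass [d i a = 0] on []-oo, a]], so the primitive starts at 0. *)
have Wa0 : W a = 0.
  have aab : a <= a <= b by rewrite lexx ltW.
  have [W0 Wa] := Wle a aab.
  move: Wa; rewrite integral_nneseries//; last 2 first.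
  - by move=> n; apply: measurable_funTS; exact: mg.
  - by move=> n x _; rewrite lee_fin.
  rewrite eseries0 ?lee_fin; last first.
    move=> i _ _; have := gE i a; rewrite lexx ltW// => /(_ isT).
    have -> : d i a = 0 by case: i => [|i] /=; rewrite !wa ?subrr.
    rewrite /Rintegral => /esym/eqP; rewrite fine_eq0; first by move/eqP.
    apply: integrable_fin_num => //; apply: integrableS (ig i) => //; exact: measurable_itv.
  by move=> Wa; apply/eqP; rewrite eq_le Wa W0.
exists W; split.
- exact: Wa0.
- by move=> t tab; rewrite -lee_fin; have [_ /le_trans] := Wle t tab; apply; exact: intG.
- exact: integral_abs_cont.
- have H1 : {ae mu, forall t, a < t < b -> derivable W t 1 /\ 'D_1 W t = h t}.
    apply: density_derivable => // t tab.
    by rewrite Wa0 subr0.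
  (* The countably many exceptional null sets are merged into one. *)
  have H2 : {ae mu, forall t, forall m, a < t < b -> derivable (d m) t 1 /\ 'D_1 (d m) t = g m t}.
    apply/ae_foralln => m; apply: density_derivable => // t tab.
    by have [_ _ <-] := gP m.
  have H3 := integrable_ae mA iG.
  move: H1 H2 H3; apply: filterS3; first exact: (ae_filter_ringOfSetsType mu).
  move=> t H1 H2 H3 tab.
  have [dW WE] := H1 tab; split => // m.
  have [dm ->] : derivable (w m) t 1 /\ 'D_1 (w m) t = \sum_(0 <= i < m.+1) g i t.
    elim: m => [|m [dm mE]]; first by rewrite big_nat1; have := H2 0%N tab.
    have -> : w m.+1 = w m \+ d m.+1 by apply/funext => x /=; lra.
    have [dd dE] := H2 m.+1 tab.
    by split; [exact: derivableD|rewrite deriveD// mE dE [RHS]big_nat_recr].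
  split => //; rewrite WE /h patchE ifT; last first.
    by rewrite inE /A /= in_itv/=; case/andP: tab => _ /ltW.
  have Gt : G t \is a fin_num by apply: H3; rewrite /A /= in_itv/=; case/andP: tab => _ /ltW.
  rewrite -lee_fin /= fineK// -sumEFin.
  by apply: nneseries_lim_ge => n _ _; rewrite lee_fin.
Unshelve. all: by end_near. Qed.

End LipschitzMonotone.

(** * Euclidean structure on vectors and on points (time, position, value) *)

Section Euclidean.
Context {R : realType} {N : nat}.
Implicit Types (x y z : 'rV[R]_N) (p q w : pt R N).

Lemma dotvC x y : dotv x y = dotv y x.
Proof. by apply: eq_bigr => i _; rewrite mulrC. Qed.

Lemma dotvDl x y z : dotv (x + y) z = dotv x z + dotv y z.
Proof. by rewrite /dotv -big_split; apply: eq_bigr => i _; rewrite mxE mulrDl. Qed.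

Lemma dotvZl a x y : dotv (a *: x) y = a * dotv x y.
Proof. by rewrite /dotv big_distrr; apply: eq_bigr => i _; rewrite mxE /= mulrA. Qed.

Lemma dotvNl x y : dotv (- x) y = - dotv x y.
Proof. by rewrite -scaleN1r dotvZl mulN1r. Qed.

Lemma dotvDr x y z : dotv x (y + z) = dotv x y + dotv x z.
Proof. by rewrite dotvC dotvDl !(dotvC x). Qed.

Lemma dotvZr a x y : dotv x (a *: y) = a * dotv x y.
Proof. by rewrite dotvC dotvZl dotvC. Qed.

Lemma dotvNr x y : dotv x (- y) = - dotv x y.
Proof. by rewrite dotvC dotvNl dotvC. Qed.

Lemma dotv0l y : dotv 0 y = 0.
Proof. by rewrite -(scale0r (0 : 'rV[R]_N)) dotvZl mul0r. Qed.

Lemma dotv0r y : dotv y 0 = 0.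
Proof. by rewrite dotvC dotv0l. Qed.

Definition dotvE := (dotvDl, dotvDr, dotvNl, dotvNr, dotvZl, dotvZr, dotv0l, dotv0r).

Lemma dotv_ge0 x : 0 <= dotv x x.
Proof. by apply: sumr_ge0 => i _; rewrite -expr2 sqr_ge0. Qed.

Lemma dotv_eq0 x : dotv x x = 0 -> x = 0.
Proof.
move=> /eqP; rewrite psumr_eq0 => [/allP x0|i _]; last by rewrite -expr2 sqr_ge0.
apply/rowP => i; rewrite mxE; have := x0 i; rewrite mem_index_enum => /(_ isT) /=.
by rewrite mulf_eq0 orbb => /eqP.
Qed.

Lemma enorm_ge0 x : 0 <= enorm x. Proof. exact: sqrtr_ge0. Qed.

Lemma enorm_sqr x : enorm x ^+ 2 = dotv x x.
Proof. by rewrite sqr_sqrtr ?dotv_ge0. Qed.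

Lemma coord_le_enorm x i : `|x 0 i| <= enorm x.
Proof.
rewrite -(ler_pXn2r (n := 2))// ?nnegrE ?enorm_ge0// enorm_sqr -normrX ger0_norm ?sqr_ge0//.
by rewrite /dotv (bigD1 i)//= expr2 lerDl sumr_ge0// => j _; rewrite -expr2 sqr_ge0.
Qed.

(** Common core of the two Cauchy-Schwarz inequalities: [a], [b], [c] stand for [<x, x>], [<x, y>],
    [<y, y>], and the quadratic is [|x - s y|^2]. *)
Lemma cauchy_schwarz_of_quadratic (a b c : R) : 0 <= a -> 0 <= c ->
  (forall s, 0 <= a - 2 * s * b + s ^+ 2 * c) -> b <= Num.sqrt a * Num.sqrt c.
Proof.
move=> a0 c0 H.
have H2 : b ^+ 2 <= a * c.
  have [c00|cn0] := eqVneq c 0.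
    have [->|bn0] := eqVneq b 0; first by rewrite expr0n mulr_ge0.
    (* With [c = 0] the expression is affine in [s]; this [s] gives it the value [-1]. *)
    have := H ((a + 1) / (2 * b)); rewrite c00 mulr0 addr0.
    have -> : 2 * ((a + 1) / (2 * b)) * b = a + 1 by field.
    lra.
  have cp : 0 < c by rewrite lt_neqAle eq_sym cn0.
  (* The minimiser of the quadratic. *)
  have := H (b / c).
  have -> : a - 2 * (b / c) * b + (b / c) ^+ 2 * c = (a * c - b ^+ 2) / c by field.
  by rewrite pmulr_lge0 ?invr_gt0// subr_ge0.
rewrite -sqrtrM//; apply: (le_trans (ler_norm b)).
by rewrite -sqrtr_sqr ler_wsqrtr.
Qed.

Lemma dotv_le x y : dotv x y <= enorm x * enorm y.
Proof.
apply: cauchy_schwarz_of_quadratic; rewrite ?dotv_ge0// => s.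
have := dotv_ge0 (x - s *: y); rewrite !dotvE (dotvC y x).
set lhs := (X in 0 <= X -> _); suff -> : lhs = dotv x x - 2 * s * dotv x y + s ^+ 2 * dotv y y by [].
by rewrite /lhs; ring.
Qed.

Lemma enormN x : enorm (- x) = enorm x.
Proof. by rewrite /enorm !dotvE opprK. Qed.

Lemma enorm_distC x y : enorm (x - y) = enorm (y - x).
Proof. by rewrite -enormN opprB. Qed.

Lemma enorm0 : enorm (0 : 'rV[R]_N) = 0.
Proof. by rewrite /enorm dotv0l sqrtr0. Qed.

Lemma enormZ a x : enorm (a *: x) = `|a| * enorm x.
Proof. by rewrite /enorm !dotvE mulrA -expr2 sqrtrM ?sqr_ge0// sqrtr_sqr. Qed.

Lemma enormD x y : enorm (x + y) <= enorm x + enorm y.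
Proof.
rewrite -(ler_pXn2r (n := 2))// ?nnegrE ?addr_ge0 ?enorm_ge0//.
rewrite enorm_sqr !dotvE sqrrD !enorm_sqr (dotvC y x).
have := dotv_le x y; rewrite mulr2n; lra.
Qed.

Lemma enorm_triangle y x z : enorm (x - z) <= enorm (x - y) + enorm (y - z).
Proof. by rewrite -(subrKA y) enormD. Qed.

Lemma abs_dotv_le x y : `|dotv x y| <= enorm x * enorm y.
Proof.
by rewrite ler_norml dotv_le andbT lerNl -dotvNl -(enormN x) dotv_le.
Qed.

Lemma pt_dot_ge0 p : 0 <= pt_dot p p.
Proof. by rewrite /pt_dot !addr_ge0 ?dotv_ge0// -expr2 sqr_ge0. Qed.

Lemma pt_norm_ge0 p : 0 <= pt_norm p. Proof. exact: sqrtr_ge0. Qed.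

Lemma pt_norm_sqr p : pt_norm p ^+ 2 = pt_dot p p.
Proof. by rewrite sqr_sqrtr ?pt_dot_ge0. Qed.

Lemma pt_dot_le p q : pt_dot p q <= pt_norm p * pt_norm q.
Proof.
apply: cauchy_schwarz_of_quadratic; rewrite ?pt_dot_ge0// => s.
have := pt_dot_ge0 (pt_sub p (pt_scale s q)).
rewrite /pt_dot /pt_sub /pt_scale /= !dotvE (dotvC q.1.2 p.1.2).
set lhs := (X in 0 <= X -> _).
suff -> : lhs = pt_dot p p - 2 * s * pt_dot p q + s ^+ 2 * pt_dot q q by [].
by rewrite /lhs /pt_dot; ring.
Qed.

Lemma pt_norm_triangle p q w :
  pt_norm (pt_sub p w) <= pt_norm (pt_sub p q) + pt_norm (pt_sub q w).
Proof.
rewrite -(ler_pXn2r (n := 2))// ?nnegrE ?addr_ge0 ?pt_norm_ge0//.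
rewrite sqrrD !pt_norm_sqr; have := pt_dot_le (pt_sub p q) (pt_sub q w).
rewrite mulr2n.
have -> : pt_dot (pt_sub p w) (pt_sub p w) = pt_dot (pt_sub p q) (pt_sub p q) +
   2 * pt_dot (pt_sub p q) (pt_sub q w) + pt_dot (pt_sub q w) (pt_sub q w).
  rewrite /pt_dot /pt_sub /= !dotvE (dotvC q.1.2 p.1.2) (dotvC w.1.2 p.1.2) (dotvC w.1.2 q.1.2).
  ring.
lra.
Qed.

Lemma pt_norm_le p : pt_norm p <= `|p.1.1| + enorm p.1.2 + `|p.2|.
Proof.
have h1 := normr_ge0 p.1.1; have h2 := enorm_ge0 p.1.2; have h3 := normr_ge0 p.2.
rewrite -(ler_pXn2r (n := 2))// ?nnegrE ?addr_ge0 ?pt_norm_ge0//.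
rewrite pt_norm_sqr /pt_dot -enorm_sqr.
have -> : p.1.1 * p.1.1 = `|p.1.1| ^+ 2 by rewrite real_normK ?num_real// expr2.
have -> : p.2 * p.2 = `|p.2| ^+ 2 by rewrite real_normK ?num_real// expr2.
nra.
Qed.

Lemma pt_norm_ge p : [/\ `|p.1.1| <= pt_norm p, enorm p.1.2 <= pt_norm p & `|p.2| <= pt_norm p].
Proof.
have h1 := sqr_ge0 p.1.1; have h2 := dotv_ge0 p.1.2; have h3 := sqr_ge0 p.2.
split; rewrite -(ler_pXn2r (n := 2))// ?nnegrE ?pt_norm_ge0 ?enorm_ge0// pt_norm_sqr /pt_dot -!expr2.
- rewrite real_normK ?num_real//; lra.
- rewrite enorm_sqr; lra.
- rewrite real_normK ?num_real//; lra.
Qed.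

Lemma enorm_cvg (T : Type) (F : set_system T) (FF : Filter F) (V : T -> 'rV[R]_N) (l : 'rV[R]_N) :
  (forall i, (fun n => V n 0 i) @ F --> l 0 i) ->
  forall eps : R, 0 < eps -> \forall n \near F, enorm (V n - l) < eps.
Proof.
move=> Vl eps eps0.
(* Dividing by [N.+1] covers [N = 0] and keeps the final estimate strict. *)
have [eta [eta0 epsE]] : exists eta : R, 0 < eta /\ eps = eta * N.+1%:R.
  by exists (eps / N.+1%:R); split; [rewrite divr_gt0|rewrite divfK// pnatr_eq0].
have H : \forall n \near F, forall i, `|l 0 i - V n 0 i| < eta.
  by apply: filter_forall => i; move/cvgrPdist_lt: (Vl i); exact.
apply: filterS H => n H.
rewrite -(ltr_pXn2r (n := 2))// ?nnegrE ?enorm_ge0 ?(ltW eps0)// enorm_sqr.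
have h : dotv (V n - l) (V n - l) <= \sum_(i < N) eta ^+ 2.
  apply: ler_sum => i _; rewrite !mxE -expr2 -real_normK ?num_real//.
  by rewrite lerXn2r ?nnegrE ?(ltW eta0)// distrC ltW.
apply: (le_lt_trans h); rewrite sumr_const card_ord -mulr_natl.
have N0 : 0 <= N%:R :> R by [].
have e2 : 0 < eta ^+ 2 by rewrite exprn_gt0.
rewrite epsE exprMn [ltLHS]mulrC (ltr_pM2l e2) -natr1; nra.
Qed.

Lemma cvg_enorm (T : Type) (F : set_system T) (FF : Filter F) (V : T -> 'rV[R]_N) (l : 'rV[R]_N) :
  V @ F --> l -> forall eps : R, 0 < eps -> \forall n \near F, enorm (V n - l) < eps.
Proof.
move=> Vl; apply: enorm_cvg => i.
by apply: (cvg_comp V (fun M : 'rV[R]_N => M 0 i) Vl); exact: coord_continuous.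
Qed.

End Euclidean.

(** * Ultrafilter limits and compactness *)

Section Ultralimit.
Context {R : realType} {N : nat}.
Implicit Types (F : set_system nat) (P : nat -> R -> 'rV[R]_N -> 'rV[R]_N -> R -> Prop).

(** The image ultrafilter clusters in the compact segment, and a cluster point of an ultrafilter is
    a limit, since every set or its complement belongs to it. *)
Lemma ultra_cvg F (FU : UltraFilter F) (a : nat -> R) B :
  (forall n, `|a n| <= B) -> exists l : R, a @ F --> l.
Proof.
move=> aB.
have cpt : compact `[- B, B]%classic := @segment_compact R (- B) B.
have [l [_ cl]] : `[- B, B]%classic `&` cluster (a @ F) !=set0.
  apply: (cpt (a @ F) (fmap_proper_filter _ _)).
  apply: (@filterS _ F _ setT _ _ filterT) => n _ /=.
  by rewrite in_itv/= -ler_norml; exact: aB.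
exists l => A /= Al.
have [//|nA] := in_ultra_setVsetC (a @^-1` A) FU.
have [x [nAx Ax]] := cl (~` A) A nA Al.
by case: nAx.
Qed.

Lemma ultra_cvgv F (FU : UltraFilter F) (V : nat -> 'rV[R]_N) B :
  (forall n, enorm (V n) <= B) ->
  exists l : 'rV[R]_N, forall i, (fun n => V n 0 i) @ F --> l 0 i.
Proof.
move=> VB.
have /choice[l lP] i : exists l : R, (fun n => V n 0 i) @ F --> l.
  apply: (@ultra_cvg F FU _ B) => n; exact: le_trans (coord_le_enorm _ _) (VB n).
by exists (\row_i l i) => i; rewrite mxE.
Qed.

Lemma ultra_oo : exists F : set_system nat, UltraFilter F /\ \oo `<=` F.
Proof. exact: ultraFilterLemma. Qed.

(** Sequential compactness in a form shared by the later arguments: the slots hold time, position,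
    velocity and value, and arguments with fewer variables put 0 in the others. The freedom to ask
    for [n >= m] lets [P n] tighten with [n]. *)
Lemma bounded_cluster_point P B :
  (forall n, exists t x v u, [/\ `|t| <= B, enorm x <= B, enorm v <= B, `|u| <= B & P n t x v u]) ->
  exists t x v u, forall (d : R) m, 0 < d -> exists n t' x' v' u',
    [/\ (m <= n)%N, `|t' - t| < d, enorm (x' - x) < d, enorm (v' - v) < d &
        `|u' - u| < d /\ P n t' x' v' u'].
Proof.
move=> /choice[t_ /choice[x_ /choice[v_ /choice[u_ H]]]].
have [F [FU ooF]] := ultra_oo.
have [t tP] : exists l : R, t_ @ F --> l by apply: (@ultra_cvg F FU _ B) => n; have [] := H n.
have [u uP] : exists l : R, u_ @ F --> l by apply: (@ultra_cvg F FU _ B) => n; have [] := H n.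
have [x xP] : exists l : 'rV[R]_N, forall i, (fun n => x_ n 0 i) @ F --> l 0 i.
  by apply: (@ultra_cvgv F FU _ B) => n; have [] := H n.
have [v vP] : exists l : 'rV[R]_N, forall i, (fun n => v_ n 0 i) @ F --> l 0 i.
  by apply: (@ultra_cvgv F FU _ B) => n; have [] := H n.
exists t, x, v, u => d m d0.
have Ft : \forall n \near F, `|t - t_ n| < d by move/cvgrPdist_lt: tP; exact.
have Fu : \forall n \near F, `|u - u_ n| < d by move/cvgrPdist_lt: uP; exact.
have Fx : \forall n \near F, enorm (x_ n - x) < d by apply: enorm_cvg.
have Fv : \forall n \near F, enorm (v_ n - v) < d by apply: enorm_cvg.
have Fm : F [set n | (m <= n)%N] by apply: ooF; exists m.
have [n [[[[h1 h2] h3] h4] h5]] := filter_ex (filterI (filterI (filterI (filterI Ft Fu) Fx) Fv) Fm).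
exists n, (t_ n), (x_ n), (v_ n), (u_ n).
by split => //; [rewrite distrC|rewrite distrC; split => //; have [] := H n].
Qed.

End Ultralimit.

(** * Nearest points and proximal normals *)

Section NearestPoint.
Context {R : realType} {N : nat}.
Implicit Types (E : set (pt R N)) (y w e : pt R N).

Definition pt_closed E := forall w,
  (forall eps : R, 0 < eps -> exists2 e, E e & pt_norm (pt_sub w e) < eps) -> E w.

(** A minimising sequence is bounded, so it clusters, and closedness puts the cluster point in
    [E]. *)
Lemma nearest_point E y : pt_closed E -> E !=set0 ->
  exists2 w, E w & forall e, E e -> pt_norm (pt_sub y w) <= pt_norm (pt_sub y e).
Proof.
move=> cE [e0 Ee0].
pose S : set R := [set pt_norm (pt_sub y e) | e in E].
have hS : has_inf S.
  split; first by exists (pt_norm (pt_sub y e0)); exists e0.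
  by exists 0 => _ [e _ <-]; exact: pt_norm_ge0.
pose D := inf S.
have DS e : E e -> D <= pt_norm (pt_sub y e).
  by move=> Ee; apply: (inf_lbound hS.2); exists e.
have Dn n : exists2 e, E e & pt_norm (pt_sub y e) < D + n.+1%:R^-1.
  have [_ [e Ee <-] h] : exists2 r, S r & r < D + n.+1%:R^-1.
    by apply: inf_adherent => //; rewrite invr_gt0.
  by exists e.
pose P (n : nat) (t : R) (x v : 'rV[R]_N) (u : R) :=
  E (t, x, u) /\ pt_norm (pt_sub y (t, x, u)) < D + n.+1%:R^-1.
pose B := `|y.1.1| + enorm y.1.2 + `|y.2| + `|D| + 1.
have [|t [x [v [u H]]]] := @bounded_cluster_point R N P B.
  move=> n; have [[[t x] u] Ee le] := Dn n; exists t, x, 0, u.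
  have le1 : pt_norm (pt_sub y (t, x, u)) <= `|D| + 1.
    apply: ltW; apply: (lt_le_trans le); rewrite lerD ?ler_norm//.
    by rewrite invf_le1// ler1n.
  have [/= h1 h2 h3] := pt_norm_ge (pt_sub y (t, x, u)).
  have k1 := normr_ge0 y.1.1; have k2 := enorm_ge0 y.1.2; have k3 := normr_ge0 y.2.
  have k4 := normr_ge0 D.
  have a1 : `|t| <= `|y.1.1| + `|y.1.1 - t|.
    by rewrite -{1}(subKr y.1.1 t) ler_normB.
  have a3 : `|u| <= `|y.2| + `|y.2 - u|.
    by rewrite -{1}(subKr y.2 u) ler_normB.
  have a2 : enorm x <= enorm y.1.2 + enorm (y.1.2 - x).
    by rewrite -{1}(subKr y.1.2 x) (le_trans (enormD _ _))// enormN.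
  split => //; rewrite /B ?enorm0; lra.
have close eps : 0 < eps -> exists2 e, E e &
    pt_norm (pt_sub (t, x, u) e) < eps /\ pt_norm (pt_sub y e) < D + eps.
  move=> eps0.
  have e3 : 0 < eps / 3 by rewrite divr_gt0.
  (* From this index on, [1 / (n + 1) <= eps]. *)
  pose m := Num.truncn (eps^-1).
  have [n [t' [x' [v' [u' [mn h1 h2 _ [h3 [Ee h4]]]]]]]] := H (eps / 3) m e3.
  exists (t', x', u') => //; split.
    apply: (le_lt_trans (pt_norm_le _)) => /=.
    rewrite distrC in h1; rewrite distrC in h3; rewrite enorm_distC in h2; lra.
  apply: (lt_le_trans h4); rewrite lerD2l -[leRHS]invrK lef_pV2 ?posrE ?invr_gt0//.
  have := Num.Theory.truncnS_gt (eps^-1); rewrite -/m => /ltW/le_trans; apply.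
  by rewrite ler_nat ltnS.
exists (t, x, u).
  by apply: cE => eps eps0; have [e Ee [h _]] := close eps eps0; exists e.
move=> e Ee; apply: le_trans (DS e Ee).
apply/ler_addgt0Pr => eps eps0.
have e2 : 0 < eps / 2 by rewrite divr_gt0.
have [e' Ee' [h1 h2]] := close _ e2.
have := pt_norm_triangle y e' (t, x, u).
have -> : pt_norm (pt_sub e' (t, x, u)) = pt_norm (pt_sub (t, x, u) e').
  rewrite /pt_norm; congr Num.sqrt; rewrite /pt_dot /pt_sub /= !dotvE; ring.
lra.
Qed.

(** If [e] in [E] is within [e1 * tau] of [w + tau zeta], expanding [|y - w|^2 <= |y - e|^2] gives
    [2 <y - w, e - w> <= |e - w|^2]. The right side is of order [tau^2] and the left side is
    [2 tau <y - w, zeta>] up to [2 |y - w| e1 tau]; it remains to divide by [tau]. *)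
Lemma proximal_normal E y w : E w ->
  (forall e, E e -> pt_norm (pt_sub y w) <= pt_norm (pt_sub y e)) ->
  normal_cone E w (pt_sub y w).
Proof.
move=> Ew near zeta tz; apply/ler_addgt0Pr => eps eps0; rewrite add0r.
set n := pt_sub y w.
have n0 := pt_norm_ge0 n; have z0 := pt_norm_ge0 zeta.
(* small enough for |n| e1 + tau (|zeta| + 1)^2 / 2 <= eps when tau < d *)
pose e1 := Num.min 1 (eps / (2 * (pt_norm n + 1))).
pose d := eps / (pt_norm zeta + 1) ^+ 2.
have e10 : 0 < e1 by rewrite lt_min ltr01 divr_gt0// mulr_gt0// ltr_wpDl.
have d0 : 0 < d by rewrite divr_gt0// exprn_gt0// ltr_wpDl.
have [tau [tau0 taud [e Ee he]]] := tz e1 d e10 d0.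
set rho := pt_sub _ e in he.
have h1 : pt_dot n n <= pt_dot (pt_sub y e) (pt_sub y e).
  by rewrite -!pt_norm_sqr lerXn2r ?nnegrE ?pt_norm_ge0// near.
pose sg := pt_sub e w.
have E1 : pt_dot (pt_sub y e) (pt_sub y e) = pt_dot n n - 2 * pt_dot n sg + pt_dot sg sg.
  rewrite /n /sg /pt_dot /pt_sub /= !dotvE (dotvC e.1.2 y.1.2) (dotvC w.1.2 y.1.2) (dotvC w.1.2 e.1.2).
  ring.
have E2 : pt_dot n sg = tau * pt_dot zeta n - pt_dot n rho.
  rewrite /n /sg /rho /pt_dot /pt_sub /pt_add /pt_scale /= !dotvE.
  rewrite !(dotvC zeta.1.2).
  ring.
have h2 : pt_dot n rho <= pt_norm n * (e1 * tau).
  by apply: (le_trans (pt_dot_le _ _)); rewrite ler_wpM2l// ltW.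
have h3 : pt_norm sg <= tau * (pt_norm zeta + 1).
  have := pt_norm_triangle e (pt_add w (pt_scale tau zeta)) w.
  have -> : pt_norm (pt_sub e (pt_add w (pt_scale tau zeta))) = pt_norm rho.
    rewrite /rho /pt_norm; congr Num.sqrt; rewrite /pt_dot /pt_sub /= !dotvE; ring.
  have -> : pt_norm (pt_sub (pt_add w (pt_scale tau zeta)) w) = tau * pt_norm zeta.
    rewrite -[X in X * _](ger0_norm (ltW tau0)) -sqrtr_sqr -sqrtrM ?sqr_ge0//.
    congr Num.sqrt; rewrite /pt_dot /pt_sub /pt_add /pt_scale /= !dotvE; ring.
  have e11 : e1 <= 1 by rewrite ge_min lexx.
  have : e1 * tau <= tau by rewrite ger_pMl.
  rewrite -/sg; lra.
have h4 : pt_dot sg sg <= tau ^+ 2 * (pt_norm zeta + 1) ^+ 2.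
  rewrite -pt_norm_sqr -exprMn lerXn2r ?nnegrE ?pt_norm_ge0// mulr_ge0//.
    exact: ltW.
  lra.
have h5 : 2 * (tau * pt_dot zeta n) <=
    tau * (2 * pt_norm n * e1 + tau * (pt_norm zeta + 1) ^+ 2).
  have -> : tau * (2 * pt_norm n * e1 + tau * (pt_norm zeta + 1) ^+ 2) =
      2 * (pt_norm n * (e1 * tau)) + tau ^+ 2 * (pt_norm zeta + 1) ^+ 2 by ring.
  lra.
have h6 : tau * (pt_norm zeta + 1) ^+ 2 <= eps.
  by rewrite -ler_pdivlMr ?exprn_gt0 ?ltr_wpDl// ltW.
have h7 : 2 * pt_norm n * e1 <= eps.
  have : e1 <= eps / (2 * (pt_norm n + 1)) by rewrite ge_min lexx orbT.
  rewrite ler_pdivlMr; last by rewrite mulr_gt0// ltr_wpDl.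
  nra.
have h8 : tau * (2 * pt_dot zeta n) <= tau * (2 * eps).
  have -> : tau * (2 * pt_dot zeta n) = 2 * (tau * pt_dot zeta n) by ring.
  by apply: (le_trans h5); rewrite ler_pM2l//; lra.
by move: h8; rewrite ler_pM2l//; lra.
Qed.

End NearestPoint.

(** * Affine minorants and lower bounds from semicontinuity *)

Section Minorants.
Context {R : realType} {N : nat}.
Implicit Types (L : R -> 'rV[R]_N -> 'rV[R]_N -> \bar R) (ell : 'rV[R]_N -> \bar R).

Lemma in_segE (t a b : R) : (t \in `[a, b]) = (a <= t <= b).
Proof. by apply/idP/idP; rewrite inE/= in_itv. Qed.

Lemma EFin_lt_dense (r : R) (y : \bar R) : (r%:E < y)%E -> exists2 s : R, r < s & (s%:E < y)%E.
Proof.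
case: y => [y| |]//=.
- by rewrite lte_fin => ry; exists ((r + y) / 2); rewrite ?lte_fin; lra.
- by exists (r + 1); [lra|exact: ltry].
Qed.

Lemma truncn_inv_lt (d : R) n : 0 < d -> (Num.truncn d^-1 <= n)%N -> n.+1%:R^-1 < d.
Proof.
move=> d0 mn; rewrite -[ltRHS]invrK ltf_pV2 ?posrE ?invr_gt0//.
have := Num.Theory.truncnS_gt (d^-1) => /lt_le_trans; apply.
by rewrite ler_nat ltnS.
Qed.

(** Project [(v0, r)], which lies strictly below the epigraph of [ell], to a point [(p, s)] of the
    epigraph. If [r < s], the supporting hyperplane is the graph of an affine function. If [r = s]
    it is vertical, and a constant below [- M] is tilted by a large multiple of [v0 - p]. *)
Lemma affine_minorant ell (M r : R) v0 :
  (forall v (r : R), (r%:E < ell v)%E -> exists2 d : R, 0 < d &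
     forall v', enorm (v' - v) < d -> (r%:E < ell v')%E) ->
  (forall v w (a b lam : R), 0 <= lam <= 1 ->
     (ell v <= a%:E)%E -> (ell w <= b%:E)%E ->
     (ell (lam *: v + (1 - lam) *: w)%R <= (lam * a + (1 - lam) * b)%:E)%E) ->
  (forall v, ((- M)%:E <= ell v)%E) -> (exists v, ell v != +oo%E) ->
  (r%:E < ell v0)%E ->
  exists a b, (forall v, ((a + dotv b v)%:E < ell v)%E) /\ r < a + dotv b v0.
Proof.
move=> lsc cvx ellM [v1 v1f] rv0.
(* The time slot is frozen at 0 so that [nearest_point] applies to the epigraph. *)
pose E : set (pt R N) := [set p | p.1.1 = 0 /\ (ell p.1.2 <= p.2%:E)%E].
have ell_ge v (c : R) : (forall b, (ell v <= b%:E)%E -> c < b) -> (c%:E < ell v)%E.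
  have := ellM v; case: (ell v) => [s| |]//= _ H; last exact: ltry.
  by rewrite lte_fin H.
have E0 : E !=set0.
  have := ellM v1; case E1 : (ell v1) v1f => [s| |]// _ _.
  by exists (0, v1, s); split => //=; rewrite E1.
have cE : pt_closed E.
  move=> [[s w] c] H; split => /=.
    apply/eqP; rewrite -normr_le0; apply/ler_addgt0Pr => eps eps0; rewrite add0r.
    have [[[s' w'] c'] [/= -> _] he] := H eps eps0.
    have [/= h _ _] := pt_norm_ge (pt_sub (s, w, c) (0, w', c')).
    by move: h; rewrite subr0 => /le_trans; apply; exact: ltW.
  rewrite leNgt; apply/negP => /EFin_lt_dense[c1 cc1 c1w].
  have [d d0 dP] := lsc _ _ c1w.
  have m0 : 0 < Num.min d (c1 - c) by rewrite lt_min d0 subr_gt0.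
  have [[[s' w'] c'] [/= _ h] he] := H _ m0.
  have [/= _ h2 h3] := pt_norm_ge (pt_sub (s, w, c) (s', w', c')).
  move: he; rewrite lt_min => /andP[he1 he2].
  have : (c1%:E < ell w')%E by apply: dP; rewrite enorm_distC; apply: le_lt_trans he1.
  move=> /lt_le_trans /(_ h); rewrite lte_fin.
  move: h3; rewrite ler_norml => /andP[h3 _]; lra.
have [[[z p] s] [/= z0 ps] near] := nearest_point (0, v0, r) cE E0.
(* Variational inequality of the projection onto a convex set: compare with points of the segment
   from [(p, s)] to [(w, be)] and let [lam] be small. *)
have var w (be : R) : (ell w <= be%:E)%E ->
    dotv (v0 - p) (w - p) + (r - s) * (be - s) <= 0.
  move=> wb; set A := _ + _.
  pose Q := dotv (w - p) (w - p) + (be - s) ^+ 2.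
  have Q0 : 0 <= Q by rewrite addr_ge0 ?dotv_ge0 ?sqr_ge0.
  have key lam : 0 < lam <= 1 -> 2 * A <= lam * Q.
    move=> /andP[l0 l1].
    have Ee : E (0, lam *: w + (1 - lam) *: p, lam * be + (1 - lam) * s).
      by split => //=; apply: cvx => //; rewrite ltW.
    have := near _ Ee.
    rewrite -(ler_pXn2r (n := 2))// ?nnegrE ?pt_norm_ge0// !pt_norm_sqr.
    rewrite /pt_dot /pt_sub /= z0 => h.
    have : lam * (2 * A) <= lam * (lam * Q).
      move: h; rewrite /A /Q !dotvE (dotvC w v0) (dotvC p v0) (dotvC p w); nra.
    by rewrite ler_pM2l.
  apply/ler_addgt0Pr => eps eps0; rewrite add0r.
  pose lam := Num.min 1 (2 * eps / (Q + 1)).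
  have l01 : 0 < lam <= 1.
    by rewrite /lam lt_min ltr01 ge_min lexx /= divr_gt0 ?mulr_gt0 ?ltr_wpDl.
  have := key _ l01.
  have : lam * (Q + 1) <= 2 * eps.
    by rewrite -ler_pdivlMr ?ltr_wpDl// /lam ge_min lexx orbT.
  case/andP: l01; nra.
(* Test with [(p, s + 1)], which also lies in the epigraph. *)
have rs : r <= s.
  have := var p (s + 1); rewrite subrr dotv0r add0r.
  have -> : s + 1 - s = 1 by ring.
  rewrite mulr1 subr_le0; apply; apply: (le_trans ps); rewrite lee_fin; lra.
have D0 := dotv_ge0 (v0 - p).
move: rs; rewrite le_eqVlt => /predU1P[rs|rs].
  have Dp : 0 < dotv (v0 - p) (v0 - p).
    rewrite lt_neqAle D0 andbT eq_sym; apply/eqP => /dotv_eq0/eqP.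
    by rewrite subr_eq0 => /eqP v0p; move: rv0; rewrite v0p ltNge rs ps.
  (* The tilt is nonpositive on the domain of [ell], since [<v0 - p, v - p> <= 0] there, and this
     factor lifts the value at [v0] to at least [r + 1]. *)
  pose lam := `|r + M + 2| / dotv (v0 - p) (v0 - p).
  have l0 : 0 <= lam by rewrite divr_ge0.
  exists (- M - 1 - lam * dotv (v0 - p) p), (lam *: (v0 - p)); split.
    move=> v; apply: ell_ge => b vb.
    have := var v b vb; rewrite rs subrr mul0r addr0 => h1.
    have h2 : - M <= b by rewrite -lee_fin (le_trans (ellM v)).
    have h3 : lam * dotv (v0 - p) (v - p) <= 0 by rewrite mulr_ge0_le0.
    move: h3; rewrite dotvZl (dotvDr (v0 - p)) dotvNr mulrDr mulrN; lra.
  have -> : - M - 1 - lam * dotv (v0 - p) p + dotv (lam *: (v0 - p)) v0 =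
     - M - 1 + lam * dotv (v0 - p) (v0 - p).
    by rewrite dotvZl (dotvDr (v0 - p) v0 (- p)) dotvNr; ring.
  rewrite /lam divfK ?gt_eqF//.
  have := ler_norm (r + M + 2); lra.
pose k := (s - r)^-1.
have sr0 : 0 < s - r by rewrite subr_gt0.
have k0 : 0 < k by rewrite invr_gt0.
(* Lowering by half the gap makes the minorant strict and keeps its value at [v0] above [r]. *)
pose eps := (s - r) / 2.
exists (s - k * dotv (v0 - p) p - eps), (k *: (v0 - p)); split.
  move=> v; apply: ell_ge => b vb.
  have := var v b vb; rewrite (dotvDr (v0 - p)) dotvNr => h1.
  rewrite dotvZl.
  have h2 : k * (dotv (v0 - p) v - dotv (v0 - p) p) <= k * ((s - r) * (b - s)).
    by rewrite ler_pM2l//; lra.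
  have h3 : k * ((s - r) * (b - s)) = b - s by rewrite mulrA /k mulVf ?gt_eqF// mul1r.
  by move: h2; rewrite h3 mulrBr /eps; lra.
rewrite dotvZl.
have : 0 <= k * dotv (v0 - p) (v0 - p) by rewrite mulr_ge0// ltW.
rewrite [in X in X -> _](dotvDr (v0 - p) v0 (- p)) dotvNr mulrDr mulrN /eps; lra.
Qed.

(** Otherwise points with [L < - n] cluster at a point where [L] exceeds some real number, against
    lower semicontinuity. *)
Lemma L_bounded_below T L (Rad C : R) : 0 <= Rad -> 0 <= C -> L1 T L -> L2 T L ->
  exists2 M : R, 0 <= M & forall (t : R) x v, t \in `[0, T] -> enorm x <= Rad -> enorm v <= C ->
    ((- M)%:E <= L t x v)%E.
Proof.
move=> Rad0 C0 l1 l2; apply: contrapT => H.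
pose P (n : nat) (t : R) (x v : 'rV[R]_N) (u : R) := t \in `[0, T] /\ (L t x v < (- n%:R)%:E)%E.
pose B := `|T| + Rad + C.
have [|t [x [v [u HP]]]] := @bounded_cluster_point R N P B.
  move=> n; apply: contrapT => H2; apply: H; exists n%:R => // t x v tT xR vC.
  rewrite leNgt; apply/negP => h; apply: H2; exists t, x, v, 0; split => //.
  - move: (tT); rewrite in_segE => /andP[t0 tT']; rewrite ger0_norm// /B.
    by have := ler_norm T; lra.
  - by have := normr_ge0 T; rewrite /B; lra.
  - by have := normr_ge0 T; rewrite /B; lra.
  - by have := normr_ge0 T; rewrite normr0 /B; lra.
(* Lower semicontinuity of [L] is given on [[0, T]] only, so the cluster time has to be placed
   there. *)
have tT : t \in `[0, T].
  rewrite in_segE; apply/andP; split; apply/ler_addgt0Pr => eps eps0.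
    have [n [t' [x' [v' [u' [_ h _ _ [_ [+ _]]]]]]]] := HP eps 0%N eps0.
    by rewrite in_segE => /andP[t0 _]; move: h; rewrite ltr_distl => /andP[]; lra.
  have [n [t' [x' [v' [u' [_ h _ _ [_ [+ _]]]]]]]] := HP eps 0%N eps0.
  by rewrite in_segE => /andP[_ tT]; move: h; rewrite ltr_distl => /andP[]; lra.
have [r rL] : exists r : R, (r%:E < L t x v)%E.
  have [_ /(_ v) + _] := l2 t x tT; case: (L t x v) => [s| |]// _.
    by exists (s - 1); rewrite lte_fin; lra.
  by exists 0; exact: ltry.
have [d d0 dP] := l1 _ _ _ _ tT rL.
have [n [t' [x' [v' [u' [mn h1 h2 h3 [_ [t'T hL]]]]]]]] := HP d (Num.truncn (- r)).+1 d0.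
have := dP t' x' v' t'T h1 h2 h3 => /lt_trans /(_ hL); rewrite lte_fin => rn.
have := Num.Theory.truncnS_gt (- r) => h.
have : (Num.truncn (- r)).+1%:R <= n%:R :> R by rewrite ler_nat.
lra.
Qed.

Lemma Uext_bounded_below T (U : R -> 'rV[R]_N -> \bar R) (B : R) :
  lsc2 (Uext T U) -> proper2 T U ->
  exists M : R, forall t x, `|t| <= B -> enorm x <= B -> ((- M)%:E <= Uext T U t x)%E.
Proof.
move=> lscU [pU _]; apply: contrapT => H.
pose P (n : nat) (t : R) (x v : 'rV[R]_N) (u : R) := (Uext T U t x < (- n%:R)%:E)%E.
have [|t [x [v [u HP]]]] := @bounded_cluster_point R N P B.
  move=> n; apply: contrapT => H2; apply: H; exists n%:R => // t x tB xB.
  rewrite leNgt; apply/negP => h; apply: H2; exists t, x, 0, 0; split => //.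
    by rewrite enorm0 (le_trans _ tB).
  by rewrite normr0 (le_trans _ tB).
have [r rL] : exists r : R, (r%:E < Uext T U t x)%E.
  rewrite /Uext; case: ifPn => [tT|_]; last by exists 0; exact: ltry.
  have := pU t x tT; case: (U t x) => [s| |]// _.
    by exists (s - 1); rewrite lte_fin; lra.
  by exists 0; exact: ltry.
have [d d0 dP] := lscU _ _ _ rL.
have [n [t' [x' [v' [u' [mn h1 h2 h3 [_ hL]]]]]]] := HP d (Num.truncn (- r)).+1 d0.
have := dP t' x' h1 h2 => /lt_trans /(_ hL); rewrite lte_fin => rn.
have := Num.Theory.truncnS_gt (- r) => h.
have : (Num.truncn (- r)).+1%:R <= n%:R :> R by rewrite ler_nat.
lra.
Qed.

(** Compactness of the ball of radius [C] makes the neighbourhood uniform in [v]: a violating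
    sequence would cluster at a [v] where the strict inequality holds. *)
Lemma local_affine_minorant T L (C a : R) (b : 'rV[R]_N) t x : L1 T L -> t \in `[0, T] ->
  (forall v, enorm v <= C -> ((a + dotv b v)%:E < L t x v)%E) ->
  exists2 rho : R, 0 < rho & forall (t' : R) x' v, t' \in `[0, T] -> `|t' - t| < rho ->
    enorm (x' - x) < rho -> enorm v <= C -> ((a + dotv b v)%:E <= L t' x' v)%E.
Proof.
move=> l1 tT ab; apply: contrapT => H.
pose P (n : nat) (t' : R) (x' v : 'rV[R]_N) (u : R) := 
  [/\ t' \in `[0, T], `|t' - t| < n.+1%:R^-1, enorm (x' - x) < n.+1%:R^-1, enorm v <= C &
      (L t' x' v < (a + dotv b v)%:E)%E].
pose B := `|t| + enorm x + `|C| + 1.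
have b1 := normr_ge0 t; have b2 := enorm_ge0 x; have b3 := normr_ge0 C.
have [|t1 [x1 [v [u HP]]]] := @bounded_cluster_point R N P B.
  move=> n; apply: contrapT => H2; apply: H; exists n.+1%:R^-1; first by rewrite invr_gt0.
  move=> t' x' v t'T ht hx vC.
  rewrite leNgt; apply/negP => h; apply: H2; exists t', x', v, 0.
  have n1 : n.+1%:R^-1 <= 1 :> R by rewrite invf_le1// ler1n.
  have {}ht1 := lt_le_trans ht n1; have {}hx1 := lt_le_trans hx n1.
  split => //.
  - have := ler_normD (t' - t) t; rewrite subrK /B; lra.
  - have := enormD (x' - x) x; rewrite subrK /B; lra.
  - by have := ler_norm C; rewrite /B; lra.
  - rewrite normr0 /B; lra.
have vC : enorm v <= C.
  apply/ler_addgt0Pr => eps eps0.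
  have [n [t' [x' [v' [u' [_ _ _ h [_ [_ _ _ vC _]]]]]]]] := HP eps 0%N eps0.
  have h1 : enorm v <= enorm (v' - v) + enorm v'.
    by rewrite enorm_distC -{1}(subrK v' v) enormD.
  by apply: (le_trans h1); rewrite addrC lerD// ltW.
have [r ar rL] := EFin_lt_dense (ab v vC).
have [d d0 dP] := l1 _ _ _ _ tT rL.
pose gap := r - (a + dotv b v).
have gap0 : 0 < gap by rewrite subr_gt0.
have be0 := enorm_ge0 b.
(* Within [d1] of [v] the affine function changes by at most [gap], hence does not exceed [r]. *)
pose d1 := Num.min d (gap / (enorm b + 1)).
have d10 : 0 < d1 by rewrite lt_min d0 divr_gt0// ltr_wpDl.
have [n [t' [x' [v' [u' [mn _ _ hv [_ [t'T ht hx v'C hL]]]]]]]] := HP d1 (Num.truncn d^-1) d10.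
have nd := truncn_inv_lt d0 mn.
move: hv; rewrite lt_min => /andP[hv1 hv2].
have := dP t' x' v' t'T (lt_trans ht nd) (lt_trans hx nd) hv1.
move=> /lt_trans /(_ hL); rewrite lte_fin.
have -> : dotv b v' = dotv b v + dotv b (v' - v) by rewrite dotvDr dotvNr; ring.
have h1 := dotv_le b (v' - v).
have h2 : enorm b * enorm (v' - v) <= gap.
  have hb : 0 < enorm b + 1 by rewrite ltr_wpDl.
  move: hv2; rewrite (ltr_pdivlMr _ _ hb) mulrDr mulr1 (mulrC (enorm b)) => hv2.
  by apply: ltW; apply: le_lt_trans hv2; rewrite lerDl enorm_ge0.
rewrite /gap in h2; lra.
Qed.

End Minorants.

(** * Proximal aiming and Euler polygons *)

Section Euler.
Context {R : realType} {N : nat}.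
Variables (T : R) (L : R -> 'rV[R]_N -> 'rV[R]_N -> \bar R) (U : R -> 'rV[R]_N -> \bar R).

Lemma epi_closed : lsc2 (Uext T U) -> pt_closed (epi T U).
Proof.
move=> lscU [[t x] u] H; rewrite /epi /= leNgt; apply/negP => /EFin_lt_dense[r ur rU].
have [d d0 dP] := lscU _ _ _ rU.
have m0 : 0 < Num.min d (r - u) by rewrite lt_min d0 subr_gt0.
have [[[t' x'] u'] Ee he] := H _ m0.
have [/= h1 h2 h3] := pt_norm_ge (pt_sub (t, x, u) (t', x', u')).
move: he; rewrite lt_min => /andP[he1 he2].
have := dP t' x'; rewrite distrC enorm_distC => /(_ (le_lt_trans h1 he1) (le_lt_trans h2 he1)).
move=> /lt_le_trans /(_ Ee); rewrite /= lte_fin.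
move: h3; rewrite ler_norml => /andP[h3 _]; lra.
Qed.

(** The upward direction [(0, 0, 1)] is tangent to an epigraph at each of its points. *)
Lemma epi_normal_le0 w n : epi T U w -> normal_cone (epi T U) w n -> n.2 <= 0.
Proof.
move=> Kw nw; have := nw (0, 0, 1); rewrite /pt_dot /= dotv0l mul0r mul1r !add0r; apply.
move=> eps delta eps0 delta0; exists (delta / 2).
have d20 : 0 < delta / 2 by rewrite divr_gt0.
split => //; first lra.
exists (w.1.1, w.1.2, w.2 + delta / 2).
  move: Kw; rewrite /epi /= => /le_trans; apply; rewrite lee_fin; lra.
rewrite /pt_norm /pt_sub /pt_add /pt_scale /= scaler0 mulr0 mulr1 !addr0 !subrr.
by rewrite /pt_dot /= dotv0l !mulr0 !addr0 sqrtr0 mulr_gt0.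
Qed.

Hypothesis HN : forall t x u nt nx nu, epi T U (t, x, u) -> t < T ->
  normal_cone (epi T U) (t, x, u) (nt, nx, nu) ->
  exists (tk : R^nat) (xk : nat -> 'rV[R]_N) (ak : R^nat) (vk : nat -> 'rV[R]_N),
    [/\ tk @ \oo --> t, xk @ \oo --> x, ak @ \oo --> 0,
        (forall k, tk k \in `[0, T] /\ L (tk k) (xk k) (vk k) \is a fin_num) &
        (forall k, nt + dotv (vk k) nx - nu * fine (L (tk k) (xk k) (vk k)) <= ak k)].

Variables (t0 u0 h0 C M : R) (x0 : 'rV[R]_N).
Hypothesis lscU : lsc2 (Uext T U).
Hypothesis K0 : epi T U (t0, x0, u0).
Hypotheses (C0 : 0 <= C) (M0 : 0 <= M) (h00 : 0 < h0) (Ch0 : C * h0 <= 1).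
Hypothesis HC : forall (t : R) x v, t \in `[0, T] -> enorm x <= enorm x0 + 2 ->
  C < enorm v -> L t x v = +oo%E.
Hypothesis HM : forall (t : R) x v, t \in `[0, T] -> enorm x <= enorm x0 + 2 ->
  enorm v <= C -> ((- M)%:E <= L t x v)%E.

(** With [n = y - w], [w] nearest to [y], one has [|n + h z|^2 = |n|^2 + 2 h <n, z> + h^2 |z|^2],
    and normality of [n] provides a direction [z] with [<n, z> <= eps]. The pair [vl] is quantified
    before the conditions on [y] and before [w0], so that [choice] yields a step map defined at
    every [y]. *)
Lemma aiming_step (del kappa eps h : R) (y : pt R N) :
  0 < del <= 1/2 -> t0 + h0 + del <= T -> 0 <= kappa -> 0 < eps -> 0 < h ->
  exists vl : 'rV[R]_N * R, [/\ enorm vl.1 <= C, - M <= vl.2 &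
    y.1.1 <= t0 + h0 -> enorm (y.1.2 - x0) <= 1 ->
    forall w0, epi T U w0 -> pt_norm (pt_sub y w0) <= del / 2 ->
    (exists t' x', [/\ t' \in `[0, T], `|t' - y.1.1| < del, enorm (x' - y.1.2) < del &
       L t' x' vl.1 = vl.2%:E]) /\
    exists2 w, epi T U w &
      pt_norm (pt_sub (pt_add y (pt_scale h (1, vl.1, - Num.min vl.2 kappa))) w) ^+ 2 <=
      pt_norm (pt_sub y w0) ^+ 2 + (2 * h * eps + h ^+ 2 * (1 + C ^+ 2 + (M + kappa) ^+ 2))].
Proof.
move=> /andP[del0 del1] delT k0 eps0 hp.
have [[[[w0 [Kw0 yw0]] yt] yx]|nG] := pselect ((((exists w0, epi T U w0 /\
    pt_norm (pt_sub y w0) <= del / 2)) /\ y.1.1 <= t0 + h0) /\ enorm (y.1.2 - x0) <= 1); last first.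
  (* Default value where the conditions on [y] fail; it still satisfies the two bounds. *)
  exists (0, 0); split => /=; rewrite ?enorm0//; first by rewrite oppr_le0.
  by move=> yt yx w0 Kw0 yw0; exfalso; apply: nG; split => //; split => //; exists w0.
have [w Kw near] := nearest_point y (epi_closed lscU) (ex_intro _ w0 Kw0).
have nn := proximal_normal Kw near.
have nu0 := epi_normal_le0 Kw nn.
have yw : pt_norm (pt_sub y w) <= del / 2 by apply: le_trans (near _ Kw0) yw0.
have [] := pt_norm_ge (pt_sub y w); move: near Kw nn nu0 yw.
case: w => [[wt wx] wu] near Kw nn nu0 yw; rewrite [(pt_sub y _).1.1]/= [(pt_sub y _).1.2]/= => h1 h2 _.
(* The hypothesis on normals concerns times before [T]; the margin [del] secures this at the nearest
   point. *)
have wT : wt < T.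
  move: (le_trans h1 yw); rewrite ler_norml => /andP[hw _]; lra.
have [tk [xk [ak [vk [ct cx ca fin le]]]]] := HN Kw wT nn.
have d20 : 0 < del / 2 by rewrite divr_gt0.
have Ft : \forall k \near \oo, `|wt - tk k| < del / 2 by move/cvgrPdist_lt: ct; exact.
have Fa : \forall k \near \oo, `|0 - ak k| < eps by move/cvgrPdist_lt: ca; exact.
have Fx : \forall k \near \oo, enorm (xk k - wx) < del / 2 by apply: cvg_enorm.
have [k [[ht ha] hx]] := filter_ex (filterI (filterI Ft Fa) Fx).
have [tkT finL] := fin k.
have xk2 : enorm (xk k) <= enorm x0 + 2.
  have a1 := enorm_triangle wx (xk k) y.1.2.
  have a2 := enormD (y.1.2 - x0) x0; rewrite subrK in a2.
  have a3 := enormD (xk k - y.1.2) y.1.2; rewrite subrK in a3.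
  rewrite (enorm_distC wx) in a1; have a4 := le_trans h2 yw; lra.
have vC : enorm (vk k) <= C.
  rewrite leNgt; apply/negP => /(HC tkT xk2) Loo; by move: finL; rewrite Loo.
pose l := fine (L (tk k) (xk k) (vk k)).
have lE : L (tk k) (xk k) (vk k) = l%:E by rewrite /l fineK.
have lM : - M <= l by rewrite -lee_fin -lE HM.
exists (vk k, l); split => // _ _ {Kw0 yw0}w0 {}Kw0 _ /=; split.
  exists (tk k), (xk k); split => //.
    have := ler_distD wt (tk k) y.1.1; rewrite (distrC (tk k) wt) (distrC wt y.1.1).
    have a4 := le_trans h1 yw; lra.
  have a1 := enorm_triangle wx (xk k) y.1.2; rewrite (enorm_distC wx) in a1.
  have a4 := le_trans h2 yw; lra.
exists (wt, wx, wu) => //.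
have near2 : pt_norm (pt_sub y (wt, wx, wu)) ^+ 2 <= pt_norm (pt_sub y w0) ^+ 2.
  by rewrite lerXn2r ?nnegrE ?pt_norm_ge0// near.
apply: (@le_trans _ _ (pt_norm (pt_sub y (wt, wx, wu)) ^+ 2 +
  (2 * h * eps + h ^+ 2 * (1 + C ^+ 2 + (M + kappa) ^+ 2)))); last by rewrite lerD2r.
set m := Num.min l kappa.
have mk : m <= kappa by rewrite ge_min lexx orbT.
have ml : m <= l by rewrite ge_min lexx.
have mM : - M <= m by rewrite le_min lM /= (le_trans _ k0)// oppr_le0.
(* The last component of [n] is nonpositive, so replacing [l] by the smaller [m] only decreases the
   left side. *)
have le1 : (y.1.1 - wt) + dotv (vk k) (y.1.2 - wx) - (y.2 - wu) * m <= eps.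
  have := le k; rewrite /= -/l => hk.
  have hak : ak k <= eps by move: ha; rewrite sub0r normrN => /(le_lt_trans (ler_norm _))/ltW.
  have : (y.2 - wu) * l <= (y.2 - wu) * m by rewrite ler_wnM2l.
  lra.
have m2 : m ^+ 2 <= (M + kappa) ^+ 2.
  by rewrite -real_normK ?num_real// lerXn2r ?nnegrE ?addr_ge0// ler_norml; apply/andP; split; have := M0; have := k0; lra.
have v2 : dotv (vk k) (vk k) <= C ^+ 2.
  by rewrite -enorm_sqr lerXn2r ?nnegrE ?enorm_ge0.
have hh : 0 <= h ^+ 2 by rewrite sqr_ge0.
have e1 : h ^+ 2 * (1 + dotv (vk k) (vk k) + m ^+ 2) <= h ^+ 2 * (1 + C ^+ 2 + (M + kappa) ^+ 2).
  by rewrite ler_wpM2l//; lra.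
have e2 : 2 * h * ((y.1.1 - wt) + dotv (vk k) (y.1.2 - wx) - (y.2 - wu) * m) <= 2 * h * eps.
  by rewrite ler_pM2l// mulr_gt0.
rewrite !pt_norm_sqr /pt_dot /pt_sub /pt_add /pt_scale /= in e1 e2 *.
rewrite !dotvE (dotvC (vk k) y.1.2) (dotvC (vk k) wx) (dotvC wx y.1.2) in e1 e2 *.
move: e1 e2; nra.
Qed.

(** Each step adds at most [2 h eps + h^2 c2] to the squared distance, so up to time [h0] the total
    is at most [h0 (2 eps + h c2) <= (del / 2)^2]; this bound is also what allows the next aiming
    step. *)
Lemma euler_approximation (del kappa : R) :
  0 < del <= 1/2 -> t0 + h0 + del <= T -> 0 <= kappa ->
  exists (h : R) (X : nat -> 'rV[R]_N) (Y : nat -> R) (V : nat -> 'rV[R]_N) (l : nat -> R),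
  [/\ 0 < h < del, X 0%N = x0 /\ Y 0%N = u0,
     forall i, X i.+1 = X i + h *: V i /\ Y i.+1 = Y i - h * Num.min (l i) kappa,
     forall i, enorm (V i) <= C /\ - M <= l i &
     forall i, i%:R * h <= h0 ->
       (exists t' x', [/\ t' \in `[0, T], `|t' - (t0 + i%:R * h)| < del, enorm (x' - X i) < del &
          L t' x' (V i) = (l i)%:E]) /\
       exists2 w, epi T U w & pt_norm (pt_sub (t0 + i%:R * h, X i, Y i) w) <= del / 2].
Proof.
move=> hdel delT k0; have /andP[del0 del1] := hdel.
pose c2 := 1 + C ^+ 2 + (M + kappa) ^+ 2.
have c20 : 0 < c2.
  by rewrite /c2; have := sqr_ge0 C; have := sqr_ge0 (M + kappa); lra.
(* [eps] and the second bound on [h] each contribute at most [del^2 / 8], half of [(del / 2)^2]. *)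
pose eps := del ^+ 2 / (16 * h0).
have eps0 : 0 < eps by rewrite divr_gt0 ?exprn_gt0// mulr_gt0.
pose h := Num.min (del / 2) (del ^+ 2 / (8 * h0 * c2)).
have hp : 0 < h by rewrite lt_min !divr_gt0 ?exprn_gt0// !mulr_gt0.
have hd : h <= del / 2 by rewrite ge_min lexx.
have hc : h0 * (2 * eps + h * c2) <= (del / 2) ^+ 2.
  have e1 : h0 * (2 * eps) = del ^+ 2 / 8 by rewrite /eps; field; rewrite gt_eqF.
  have : h <= del ^+ 2 / (8 * h0 * c2) by rewrite ge_min lexx orbT.
  rewrite ler_pdivlMr ?mulr_gt0// => e2.
  have -> : (del / 2) ^+ 2 = del ^+ 2 / 4 by field.
  rewrite mulrDr e1; have -> : h0 * (h * c2) = h * (8 * h0 * c2) / 8 by field.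
  lra.
have /choice[f fP] := fun y => aiming_step y hdel delT k0 eps0 hp.
pose stp y := pt_add y (pt_scale h (1, (f y).1, - Num.min (f y).2 kappa)).
pose y i := iter i stp (t0, x0, u0).
have yS i : y i.+1 = stp (y i) by [].
have yt i : (y i).1.1 = t0 + i%:R * h.
  elim: i => [|i ih]; first by rewrite mul0r addr0.
  by rewrite yS /= ih -natr1; ring.
have yx i : enorm ((y i).1.2 - x0) <= i%:R * h * C.
  elim: i => [|i ih]; first by rewrite subrr enorm0 !mul0r.
  rewrite yS /= addrAC (le_trans (enormD _ _))// -natr1 mulrDl mulrDl lerD// mul1r.
  by rewrite enormZ gtr0_norm// ler_pM2l//; have [] := fP (y i).
have inv i : i%:R * h <= h0 -> exists2 w, epi T U w &
    pt_norm (pt_sub (y i) w) ^+ 2 <= i%:R * (2 * h * eps + h ^+ 2 * c2).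
  elim: i => [|i ih] ih0.
    exists (t0, x0, u0) => //; rewrite mul0r /y /= pt_norm_sqr /pt_dot /pt_sub /= !subrr.
    by rewrite dotv0l mulr0 !addr0.
  have ih1 : i%:R * h <= h0 by apply: le_trans ih0; rewrite ler_pM2r// ler_nat.
  have [w0 Kw0 hw0] := ih ih1.
  have [_ _] := fP (y i).
  have g1 : (y i).1.1 <= t0 + h0 by rewrite yt lerD2l.
  have g2 : enorm ((y i).1.2 - x0) <= 1.
    apply: (le_trans (yx i)); apply: le_trans Ch0; rewrite mulrC ler_wpM2l//.
  have g3 : pt_norm (pt_sub (y i) w0) <= del / 2.
    rewrite -(ler_pXn2r (n := 2))// ?nnegrE ?pt_norm_ge0 ?divr_ge0 ?(ltW del0)//.
    apply: (le_trans hw0); apply: le_trans hc.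
    have -> : i%:R * (2 * h * eps + h ^+ 2 * c2) = i%:R * h * (2 * eps + h * c2) by ring.
    rewrite ler_wpM2r//; apply: addr_ge0; rewrite mulr_ge0// ltW//.
  move=> /(_ g1 g2 w0 Kw0 g3)[_ [w Kw hw]].
  exists w => //; apply: (le_trans hw).
  by rewrite -(natr1 i) [X in _ <= X]mulrDl mul1r lerD2r.
exists h, (fun i => (y i).1.2), (fun i => (y i).2), (fun i => (f (y i)).1), (fun i => (f (y i)).2).
split.
- by rewrite hp /=; lra.
- by [].
- by move=> i; rewrite yS /= mulrN.
- by move=> i; have [] := fP (y i).
- move=> i ih1; have [w0 Kw0 hw0] := inv i ih1.
  have [_ _] := fP (y i).
  have g1 : (y i).1.1 <= t0 + h0 by rewrite yt lerD2l.
  have g2 : enorm ((y i).1.2 - x0) <= 1.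
    apply: (le_trans (yx i)); apply: le_trans Ch0; rewrite mulrC ler_wpM2l//.
  have g3 : pt_norm (pt_sub (y i) w0) <= del / 2.
    rewrite -(ler_pXn2r (n := 2))// ?nnegrE ?pt_norm_ge0 ?divr_ge0 ?(ltW del0)//.
    apply: (le_trans hw0); apply: le_trans hc.
    have -> : i%:R * (2 * h * eps + h ^+ 2 * c2) = i%:R * h * (2 * eps + h * c2) by ring.
    rewrite ler_wpM2r//; apply: addr_ge0; rewrite mulr_ge0// ltW//.
  move=> /(_ g1 g2 w0 Kw0 g3)[+ _]; rewrite yt => hL; split => //.
  by exists w0 => //; rewrite -yt; case: (y i) g3 => -[].
Qed.

End Euler.

(** * Ultrafilter limit of the polygons *)

Section Limit.
Context {R : realType} {N : nat}.
Variables (T : R) (L : R -> 'rV[R]_N -> 'rV[R]_N -> \bar R) (U : R -> 'rV[R]_N -> \bar R).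
Variables (t0 u0 h0 C M : R) (x0 : 'rV[R]_N).
Hypotheses (C0 : 0 <= C) (M0 : 0 <= M) (h00 : 0 < h0) (t00 : 0 <= t0) (h0T : t0 + h0 <= T).
Hypotheses (lscU : lsc2 (Uext T U)) (pU : proper2 T U) (l1 : L1 T L).

(** Polygon [k] has step [h k], truncation level [k] and accuracy [1 / (k + 1)]; [l k i] is the
    value of [L] before truncation. *)
Variables (h : nat -> R) (X : nat -> nat -> 'rV[R]_N) (Y : nat -> nat -> R)
  (V : nat -> nat -> 'rV[R]_N) (l : nat -> nat -> R).
Hypothesis hP : forall k, 0 < h k < k.+1%:R^-1.
Hypothesis XY0 : forall k, X k 0%N = x0 /\ Y k 0%N = u0.
Hypothesis XYS : forall k i, X k i.+1 = X k i + h k *: V k i /\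
  Y k i.+1 = Y k i - h k * Num.min (l k i) k%:R.
Hypothesis VlP : forall k i, enorm (V k i) <= C /\ - M <= l k i.
Hypothesis LP : forall k i, i%:R * h k <= h0 ->
  exists t' x', [/\ t' \in `[0, T], `|t' - (t0 + i%:R * h k)| < k.+1%:R^-1,
    enorm (x' - X k i) < k.+1%:R^-1 & L t' x' (V k i) = (l k i)%:E].
Hypothesis KP : forall k i, i%:R * h k <= h0 ->
  exists2 w, epi T U w & pt_norm (pt_sub (t0 + i%:R * h k, X k i, Y k i) w) <= k.+1%:R^-1.

Variables (F : set_system nat).
Hypotheses (FU : UltraFilter F) (ooF : \oo `<=` F).

Let h_gt0 k : 0 < h k. Proof. by have /andP[] := hP k. Qed.

Let h_near (e : R) : 0 < e -> \forall k \near F, k.+1%:R^-1 < e.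
Proof. by move=> e0; apply: ooF; exists (Num.truncn e^-1) => // k; exact: truncn_inv_lt. Qed.

Lemma ultra_le (a b : nat -> R) la lb : a @ F --> la -> b @ F --> lb ->
  (forall eps, 0 < eps -> \forall n \near F, a n <= b n + eps) -> la <= lb.
Proof.
move=> aP bP H; apply/ler_addgt0Pr => eps eps0.
have e3 : 0 < eps / 3 by rewrite divr_gt0.
have Fa : \forall n \near F, `|la - a n| < eps / 3 by move/cvgrPdist_lt: aP; exact.
have Fb : \forall n \near F, `|lb - b n| < eps / 3 by move/cvgrPdist_lt: bP; exact.
have [n [[h1 h2] h3]] := filter_ex (filterI (filterI Fa Fb) (H _ e3)).
move: h1 h2; rewrite !ltr_distl => /andP[_ h1] /andP[h2 _]; lra.
Qed.

Lemma ultra_leB (a b : nat -> R) la lb c : a @ F --> la -> b @ F --> lb ->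
  (forall eps, 0 < eps -> \forall n \near F, a n - b n <= c + eps) -> la - lb <= c.
Proof.
move=> aP bP H; apply: (@ultra_le (fun n => a n - b n) (cst c)) => //; last exact: cvg_cst.
exact: cvgB.
Qed.

(** Telescoping, so that bounds on the polygons can be checked one step at a time. *)
Lemma incr_le (f g : nat -> R) I J : (I <= J)%N ->
  (forall i, (I <= i < J)%N -> f i.+1 - f i <= g i.+1 - g i) -> f J - f I <= g J - g I.
Proof.
move=> /subnK <-; elim: (J - I)%N => [|d ih] H; first by rewrite add0n !subrr.
rewrite addSn.
have /ih : forall i, (I <= i < d + I)%N -> f i.+1 - f i <= g i.+1 - g i.
  by move=> i /andP[Ii id]; apply: H; rewrite Ii addSn ltnW.
have := H (d + I)%N; rewrite leq_addl addSn leqnn => /(_ isT); lra.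
Qed.

(* Times are clamped to [[t0, t0 + h0]] so that the limit curves are defined, and Lipschitz, on all of [R]. *)
Definition clamp (t : R) := Num.max t0 (Num.min t (t0 + h0)).
(** Curves are read at the last node up to [t], without interpolation; the errors are of order [h k]
    and vanish in the limit. *)
Definition grid_idx k (t : R) := Num.truncn ((clamp t - t0) / h k).

Lemma clamp_itv t : t0 <= clamp t <= t0 + h0.
Proof. by rewrite /clamp le_max lexx /= ge_max lerDl (ltW h00) /= ge_min lexx orbT. Qed.

Lemma clamp_id t : t0 <= t <= t0 + h0 -> clamp t = t.
Proof. by move=> /andP[a b]; rewrite /clamp min_l// max_r. Qed.

Lemma clamp_le s t : s <= t -> clamp s <= clamp t /\ clamp t - clamp s <= t - s.
Proof.
rewrite /clamp => st.
case: (leP t (t0 + h0)) => h1; case: (leP s (t0 + h0)) => h2;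
 [case: (leP t0 t) => h3; case: (leP t0 s) => h4| |case: (leP t0 (t0 + h0)) => h3; case: (leP t0 s) => h4|
 case: (leP t0 (t0 + h0)) => h3]; split; try lra.
all: case: (leP t0 t) => h3; case: (leP t0 (t0 + h0)) => h4; lra.
Qed.

Lemma grid_idx_itv k t : (grid_idx k t)%:R * h k <= clamp t - t0 < (grid_idx k t)%:R * h k + h k.
Proof.
have /andP[c1 c2] := clamp_itv t.
have q0 : 0 <= (clamp t - t0) / h k by rewrite divr_ge0 ?subr_ge0// ltW.
have /andP[a b] := Num.Theory.truncn_itv q0.
have -> : (grid_idx k t)%:R * h k + h k = (grid_idx k t).+1%:R * h k by rewrite -natr1 mulrDl mul1r.
by rewrite -ler_pdivlMr// a /= -ltr_pdivrMr.
Qed.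

Lemma grid_idx_le k s t : s <= t -> (grid_idx k s <= grid_idx k t)%N.
Proof.
move=> /clamp_le[st _]; apply: Num.Theory.le_truncn.
by rewrite ler_pM2r ?invr_gt0// lerD2r.
Qed.

Lemma grid_idx_h0 k t i : (i <= grid_idx k t)%N -> i%:R * h k <= h0.
Proof.
move=> it; have /andP[c1 c2] := clamp_itv t; have /andP[a _] := grid_idx_itv k t.
have : i%:R * h k <= (grid_idx k t)%:R * h k by rewrite ler_pM2r// ler_nat.
lra.
Qed.

Lemma grid_idx_diff k s t : s <= t ->
  clamp t - clamp s - h k <= (grid_idx k t)%:R * h k - (grid_idx k s)%:R * h k <= clamp t - clamp s + h k.
Proof.
by have /andP[a b] := grid_idx_itv k s; have /andP[c d] := grid_idx_itv k t; move=> _; apply/andP; split; lra.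
Qed.

Lemma grid_idx_t0 k : grid_idx k t0 = 0%N.
Proof.
rewrite /grid_idx clamp_id ?lexx ?lerDl ?(ltW h00)// subrr mul0r.
exact: Num.Theory.truncn0.
Qed.

Lemma euler_lip k I J : (I <= J)%N -> enorm (X k J - X k I) <= C * (J%:R * h k - I%:R * h k).
Proof.
move=> /subnK <-; elim: (J - I)%N => [|d ih]; first by rewrite add0n !subrr enorm0 mulr0.
rewrite addSn; have [-> _] := XYS k (d + I).
rewrite addrAC (le_trans (enormD _ _))//.
have [vC _] := VlP k (d + I).
have : enorm (h k *: V k (d + I)) <= h k * C by rewrite enormZ gtr0_norm// ler_pM2l.
by rewrite -natr1; lra.
Qed.

(* [M] is added so that the terms are nonnegative. *)
Definition tcost k (m : nat) n := \sum_(i < n) h k * (M + Num.min (l k i) m%:R).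

Lemma tcostS k m n : tcost k m n.+1 = tcost k m n + h k * (M + Num.min (l k n) m%:R).
Proof. by rewrite /tcost big_ord_recr. Qed.

Let minl_ge k (m : nat) i : - M <= Num.min (l k i) m%:R.
Proof.
have [_ lM] := VlP k i; rewrite le_min lM /=.
by apply: (@le_trans _ _ 0) => //; rewrite oppr_le0.
Qed.

(** Each summand lies between 0 and [h k (M + m)]; the Lipschitz constant does not depend on [k] and
    so survives the limit. *)
Lemma tcost_lip k m I J : (I <= J)%N ->
  0 <= tcost k m J - tcost k m I <= (M + m%:R) * (J%:R * h k - I%:R * h k).
Proof.
move=> IJ; apply/andP; split.
  rewrite -[leLHS](subrr (0 : R)); apply: (@incr_le (fun=> 0) (tcost k m) I J IJ) => i _.
  rewrite tcostS subrr addrAC subrr add0r mulr_ge0 ?(ltW (h_gt0 k))//.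
  by have := minl_ge k m i; lra.
rewrite mulrBr; apply: (@incr_le (tcost k m) (fun i => (M + m%:R) * (i%:R * h k)) I J IJ) => i _.
rewrite tcostS addrAC subrr add0r -mulrBr -mulrBl.
rewrite -natr1 addrAC subrr add0r mul1r mulrC ler_pM2r// lerD2l.
by rewrite ge_min lexx orbT.
Qed.

Lemma tcost_incr k m I J : (I <= J)%N -> tcost k m J - tcost k m I <= tcost k m.+1 J - tcost k m.+1 I.
Proof.
move=> IJ; apply: incr_le => // i _; rewrite !tcostS addrAC subrr add0r addrAC subrr add0r.
rewrite ler_pM2l// lerD2l le_min ge_min lexx /= ge_min ler_nat leqnSn orbT//.
Qed.

(** For [m = k] this is an equality, since [Y k] decreases by the values truncated at level [k]; a
    lower level only decreases the left side. *)
Lemma tcost_le_Y k m J : (m <= k)%N -> tcost k m J <= M * (J%:R * h k) + u0 - Y k J.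
Proof.
move=> mk; have := @incr_le (tcost k m) (fun i => M * (i%:R * h k) - Y k i) 0 J (leq0n _).
rewrite /tcost big_ord0 subr0 mul0r mulr0 sub0r (XY0 k).2 opprK.
suff H : forall i, (0 <= i < J)%N -> tcost k m i.+1 - tcost k m i <=
   M * (i.+1%:R * h k) - Y k i.+1 - (M * (i%:R * h k) - Y k i).
  by move=> /(_ H); rewrite /tcost; lra.
move=> i _; rewrite tcostS (XYS k i).2 -natr1.
have : Num.min (l k i) m%:R <= Num.min (l k i) k%:R.
  by rewrite le_min ge_min lexx /= ge_min ler_nat mk orbT.
have := h_gt0 k; nra.
Qed.

(** From below: the polygon is close to the epigraph and [U] is bounded below on bounded sets. From
    above: [Y] grows at rate at most [M]. *)
Lemma euler_value_bounded : exists B, forall k t, `|Y k (grid_idx k t)| <= B.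
Proof.
pose B1 := `|t0| + h0 + 1 + enorm x0 + C * h0.
have [MU MUP] := Uext_bounded_below B1 lscU pU.
exists (`|MU| + 1 + `|u0| + M * h0) => k t.
have ih := grid_idx_h0 (leqnn (grid_idx k t)).
have k1 : k.+1%:R^-1 <= 1 :> R by rewrite invf_le1// ler1n.
have [[[wt wx] wu] Kw hw] := KP ih; have {}hw := le_trans hw k1.
have [/= a1 a2 a3] := pt_norm_ge (pt_sub (t0 + (grid_idx k t)%:R * h k, X k (grid_idx k t), Y k (grid_idx k t)) (wt, wx, wu)).
have {}a1 := le_trans a1 hw; have {}a2 := le_trans a2 hw; have {}a3 := le_trans a3 hw.
have p1 := normr_ge0 t0; have p2 := enorm_ge0 x0; have p3 := mulr_ge0 C0 (ltW h00).
have p4 : 0 <= (grid_idx k t)%:R * h k by rewrite mulr_ge0// ltW.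
have b1 : `|wt| <= B1.
  move: a1; rewrite ler_distl => /andP[a1 a1'].
  have := ler_norm t0; have := lerNnormlW (lexx (`|t0|)).
  rewrite ler_norml /B1 => ? ?; apply/andP; split; lra.
have b2 : enorm wx <= B1.
  have := euler_lip k (leq0n (grid_idx k t)); rewrite (XY0 k).1 mul0r subr0 => c1.
  have c2 : C * ((grid_idx k t)%:R * h k) <= C * h0 by rewrite ler_wpM2l.
  have c3 := enormD (X k (grid_idx k t) - x0) x0; rewrite subrK in c3.
  have c4 := enormD (wx - X k (grid_idx k t)) (X k (grid_idx k t)); rewrite subrK enorm_distC in c4.
  rewrite /B1; lra.
have lo : - MU <= wu by rewrite -lee_fin (le_trans (MUP _ _ b1 b2)).
have hi : Y k (grid_idx k t) <= u0 + M * h0.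
  have := tcost_le_Y (grid_idx k t) (leq0n k).
  have := tcost_lip k 0 (leq0n (grid_idx k t)); rewrite {2}/tcost big_ord0 subr0 => /andP[s0 _].
  have : M * ((grid_idx k t)%:R * h k) <= M * h0 by rewrite ler_wpM2l.
  lra.
move: a3; rewrite ler_distl => /andP[a3 a3'].
have := ler_norm u0; have := ler_norm MU; have q0 := mulr_ge0 M0 (ltW h00).
have := normr_ge0 u0; have := normr_ge0 MU.
rewrite ler_norml => ? ? ? ?; apply/andP; split; lra.
Qed.

(** The last clause is the integrated form of [a + <b, x'> <= (w m)' - M]; unlike a statement on
    derivatives it passes to pointwise limits. The condition on [m] keeps the truncation level above
    the affine function on the ball of radius [C]. *)
Lemma euler_limit : exists (x : R -> 'rV[R]_N) (u : R -> R) (w : nat -> R -> R),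
  [/\ (forall j, lipR C (fun t => x t 0 j)) /\ (x t0 = x0 /\ u t0 = u0),
      [/\ forall m, lipR (M + m%:R) (w m), {homo w 0%N : s t / s <= t},
        forall m, {homo (fun t => w m.+1 t - w m t) : s t / s <= t} & forall m, w m t0 = 0],
      forall m t, t0 <= t <= t0 + h0 -> w m t <= M * (t - t0) + u0 - u t,
      forall t, t0 <= t <= t0 + h0 -> (U t (x t) <= (u t)%:E)%E &
      forall t a b (m : nat), t0 < t < t0 + h0 -> `|a| + enorm b * C <= m%:R ->
        (forall v, enorm v <= C -> ((a + dotv b v)%:E < L t (x t) v)%E) ->
        exists2 rho : R, 0 < rho & forall s s', t - rho < s -> s <= s' -> s' < t + rho ->
          (M + a) * (s' - s) + dotv b (x s' - x s) <= w m s' - w m s].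
Proof.
have /choice[x xP] t : exists x : 'rV[R]_N, forall j, (fun k => X k (grid_idx k t) 0 j) @ F --> x 0 j.
  apply: (@ultra_cvgv R N F FU _ (enorm x0 + C * h0)) => k.
  have := euler_lip k (leq0n (grid_idx k t)); rewrite (XY0 k).1 mul0r subr0 => c1.
  have c2 : C * ((grid_idx k t)%:R * h k) <= C * h0 by rewrite ler_wpM2l// (grid_idx_h0 (leqnn _)).
  have c3 := enormD (X k (grid_idx k t) - x0) x0; rewrite subrK in c3; lra.
have /choice[u uP] t : exists u : R, (fun k => Y k (grid_idx k t)) @ F --> u.
  have [B BP] := euler_value_bounded; apply: (@ultra_cvg R F FU _ B) => k; exact: BP.
have /choice[w_ w_P] (mt : nat * R) : exists w : R, (fun k => tcost k mt.1 (grid_idx k mt.2)) @ F --> w.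
  apply: (@ultra_cvg R F FU _ ((M + mt.1%:R) * h0)) => k.
  have := tcost_lip k mt.1 (leq0n (grid_idx k mt.2)); rewrite {2 4}/tcost big_ord0 mul0r !subr0 => /andP[s0 s1].
  rewrite ger0_norm// (le_trans s1)// ler_wpM2l ?addr_ge0// (grid_idx_h0 (leqnn _))//.
pose w m t := w_ (m, t).
have wP m t : (fun k => tcost k m (grid_idx k t)) @ F --> w m t := w_P (m, t).
have hF (e : R) : 0 < e -> \forall k \near F, h k < e.
  move=> /h_near; apply: filterS => k; apply: lt_trans; by have /andP[] := hP k.
have cF (c e : R) : 0 <= c -> 0 < e -> \forall k \near F, c * h k <= e.
  move=> c0 e0; have e1 : 0 < e / (c + 1) by rewrite divr_gt0// ltr_wpDl.
  apply: filterS (hF _ e1) => k; rewrite ltr_pdivlMr ?ltr_wpDl// => /ltW.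
  have := h_gt0 k; rewrite mulrDr mulr1 mulrC; lra.
have xlip j s t : s <= t -> `|x t 0 j - x s 0 j| <= C * (t - s).
  move=> st; have [c1 c2] := clamp_le st.
  have near_ e : 0 < e -> \forall k \near F,
      `|X k (grid_idx k t) 0 j - X k (grid_idx k s) 0 j| <= C * (t - s) + e.
    move=> e0; apply: filterS (cF C e C0 e0) => k hk.
    have := coord_le_enorm (X k (grid_idx k t) - X k (grid_idx k s)) j; rewrite !mxE => /le_trans; apply.
    apply: (le_trans (euler_lip k (grid_idx_le k st))).
    apply: (@le_trans _ _ (C * (t - s + h k))); last by rewrite mulrDr lerD2l.
    rewrite ler_wpM2l//; have /andP[_] := grid_idx_diff k st; lra.
  rewrite ler_norml; apply/andP; split.
    rewrite lerNl opprB; apply: (ultra_leB (xP s j) (xP t j)) => e e0.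
    apply: filterS (near_ e e0) => k; rewrite distrC; apply: le_trans; exact: ler_norm.
  apply: (ultra_leB (xP t j) (xP s j)) => e e0.
  apply: filterS (near_ e e0) => k; apply: le_trans; exact: ler_norm.
have wlip m s t : s <= t -> 0 <= w m t - w m s <= (M + m%:R) * (t - s).
  move=> st; have [c1 c2] := clamp_le st.
  have Mm : 0 <= M + m%:R by rewrite addr_ge0.
  apply/andP; split.
    rewrite subr_ge0; apply: (ultra_le (wP m s) (wP m t)) => e e0.
    apply: filterS filterT => k _.
    by have /andP[+ _] := tcost_lip k m (grid_idx_le k st); lra.
  apply: (ultra_leB (wP m t) (wP m s)) => e e0.
  apply: filterS (cF _ e Mm e0) => k hk.
  have /andP[_ /le_trans] := tcost_lip k m (grid_idx_le k st); apply.
  apply: (@le_trans _ _ ((M + m%:R) * (t - s + h k))); last by rewrite mulrDr lerD2l.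
  rewrite ler_wpM2l//; have /andP[_] := grid_idx_diff k st; lra.
have itv_t0 : t0 <= t0 <= t0 + h0 by rewrite lexx lerDl ltW.
have t0_ge0 := t00; have t0h0_le := h0T.
exists x, u, w; split.
- split.
    move=> j s t; have [st|/ltW ts] := leP s t.
      by rewrite (ger0_norm (_ : 0 <= t - s)) ?subr_ge0//; exact: xlip.
    by rewrite distrC (distrC t) (ger0_norm (_ : 0 <= s - t)) ?subr_ge0//; exact: xlip.
  split.
    apply/rowP => j; apply: (cvg_unique _ (xP t0 j)) => //.
    rewrite (_ : (fun k => _) = cst (x0 0 j)); first exact: cvg_cst.
    by apply/funext => k; rewrite grid_idx_t0 (XY0 k).1.
  apply: (cvg_unique _ (uP t0)) => //.
  rewrite (_ : (fun k => _) = cst u0); first exact: cvg_cst.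
  by apply/funext => k; rewrite grid_idx_t0 (XY0 k).2.
- split.
  + move=> m s t; have [st|/ltW ts] := leP s t.
      have /andP[a b] := wlip m s t st.
      by rewrite !ger0_norm ?subr_ge0// -subr_ge0.
    have /andP[a b] := wlip m t s ts.
    by rewrite distrC (distrC t) !ger0_norm ?subr_ge0// -subr_ge0.
  + by move=> s t st; rewrite -subr_ge0; have /andP[] := wlip 0%N s t st.
  + move=> m s t st /=.
    apply: (ultra_le (cvgB (wP m.+1 s) (wP m s)) (cvgB (wP m.+1 t) (wP m t))) => e e0.
    apply: filterS filterT => k _; rewrite !fctE.
    by have := tcost_incr k m (grid_idx_le k st); lra.
  + move=> m; apply: (cvg_unique _ (wP m t0)) => //.
    rewrite (_ : (fun k => _) = cst 0); first exact: cvg_cst.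
    by apply/funext => k; rewrite grid_idx_t0 /tcost big_ord0.
- move=> m t tt.
  suff : w m t - (- u t) <= M * (t - t0) + u0 by lra.
  apply: (ultra_leB (wP m t) (cvgN (uP t))) => e e0.
  have Fm : F [set n | (m <= n)%N] by apply: ooF; exists m.
  apply: filterS Fm => k mk; rewrite fctE opprK.
  have := tcost_le_Y (grid_idx k t) mk; have /andP[a _] := grid_idx_itv k t; rewrite clamp_id// in a.
  have : M * ((grid_idx k t)%:R * h k) <= M * (t - t0) by rewrite ler_wpM2l.
  lra.
- move=> t tt.
  (* For suitable [k] the node is near [(t, x t, u t)] and within [1 / (k + 1)] of the epigraph,
     which is closed. *)
  have : epi T U (t, x t, u t).
    apply: (epi_closed lscU) => e e0.
    have e8 : 0 < e / 8 by rewrite divr_gt0.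
    have Fx : \forall k \near F, enorm (X k (grid_idx k t) - x t) < e / 8.
      by apply: enorm_cvg.
    have Fu : \forall k \near F, `|u t - Y k (grid_idx k t)| < e / 8.
      by move/cvgrPdist_lt: (uP t); exact.
    have [k [[[hx hu] hk] hh]] := filter_ex (filterI (filterI (filterI Fx Fu) (h_near e8)) (hF _ e8)).
    have [v Kv hv] := KP (grid_idx_h0 (leqnn (grid_idx k t))).
    have {}hv := le_lt_trans hv hk.
    exists v => //.
    have /andP[i1 i2] := grid_idx_itv k t; rewrite clamp_id// in i1 i2.
    apply: (le_lt_trans (pt_norm_triangle _ (t0 + (grid_idx k t)%:R * h k, X k (grid_idx k t), Y k (grid_idx k t)) _)).
    have /= n1 := pt_norm_le (pt_sub (t, x t, u t) (t0 + (grid_idx k t)%:R * h k, X k (grid_idx k t), Y k (grid_idx k t))).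
    have n2 : `|t - (t0 + (grid_idx k t)%:R * h k)| < e / 8 by rewrite ger0_norm; lra.
    rewrite enorm_distC in n1; lra.
  have tT : t \in `[0, T] by rewrite in_segE; case/andP: tt => ? ?; apply/andP; split; lra.
  by rewrite /epi /= /Uext tT.
- move=> t a b m /andP[t1 t2] abm Hmin.
  have tT : t \in `[0, T] by rewrite in_segE; apply/andP; split; lra.
  have [rho rho0 rhoP] := local_affine_minorant l1 tT Hmin.
  (* The first two bounds keep the interval inside [[t0, t0 + h0]], where [clamp] is the identity;
     the third keeps the nodes, which drift by at most [C (r + h k)], in the region where the
     minorant is valid. *)
  pose r := Num.min (Num.min (t - t0) (t0 + h0 - t)) (rho / (4 * (C + 1))).
  have C1 : 0 < C + 1 by rewrite ltr_wpDl.
  have r0 : 0 < r.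
    by rewrite !lt_min !subr_gt0 t1 t2 /= divr_gt0// mulr_gt0.
  have r1 : r <= t - t0 by rewrite /r !ge_min lexx.
  have r2 : r <= t0 + h0 - t by rewrite /r !ge_min lexx orbT.
  have r3 : r * (4 * (C + 1)) <= rho.
    by rewrite -ler_pdivlMr ?mulr_gt0// /r ge_min lexx orbT.
  exists r => // s s' s1 ss' s2.
  have cs : clamp s = s by apply: clamp_id; apply/andP; split; lra.
  have cs' : clamp s' = s' by apply: clamp_id; apply/andP; split; lra.
  have ct : clamp t = t by apply: clamp_id; apply/andP; split; lra.
  have cvgb : (fun k => dotv b (X k (grid_idx k s') - X k (grid_idx k s))) @ F --> dotv b (x s' - x s).
    apply/cvgrPdist_lt => e e0.
    have be0 : 0 < enorm b + 1 by rewrite ltr_wpDl// enorm_ge0.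
    have e1 : 0 < e / (2 * (enorm b + 1)) by rewrite divr_gt0// mulr_gt0.
    have Fs' : \forall k \near F, enorm (X k (grid_idx k s') - x s') < e / (2 * (enorm b + 1)).
      by apply: enorm_cvg.
    have Fs : \forall k \near F, enorm (X k (grid_idx k s) - x s) < e / (2 * (enorm b + 1)).
      by apply: enorm_cvg.
    apply: filterS (filterI Fs' Fs) => k [].
    rewrite !ltr_pdivlMr ?mulr_gt0// => hs' hs.
    rewrite -dotvNr -dotvDr; apply: (le_lt_trans (abs_dotv_le _ _)).
    have -> : x s' - x s - (X k (grid_idx k s') - X k (grid_idx k s)) =
       (X k (grid_idx k s) - x s) - (X k (grid_idx k s') - x s').
      by apply/rowP => j; rewrite !mxE; ring.
    have zpq := enormD (X k (grid_idx k s) - x s) (- (X k (grid_idx k s') - x s')); rewrite enormN in zpq.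
    have {}zpq := ler_wpM2l (enorm_ge0 b) zpq.
    apply: (le_lt_trans zpq).
    have := enorm_ge0 (X k (grid_idx k s) - x s); have := enorm_ge0 (X k (grid_idx k s') - x s').
    move: hs hs'; set p := enorm (_ - x s); set q := enorm (_ - x s'); lra.
  apply: (ultra_le (cvgD (cvg_cst ((M + a) * (s' - s))) cvgb) (cvgB (wP m s') (wP m s))) => e e0.
  have rho4 : 0 < rho / 4 by rewrite divr_gt0.
  have rho8 : 0 < rho / 8 by rewrite divr_gt0.
  have Fx : \forall k \near F, enorm (X k (grid_idx k t) - x t) < rho / 4 by apply: enorm_cvg.
  apply: filterS (filterI (filterI (filterI (filterI Fx (h_near rho4)) (cF _ _ (normr_ge0 (M + a)) e0))
    (cF _ _ C0 rho8)) (hF _ rho8)) => k [[[[hx hk] hMa] hC] hh].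
  rewrite !fctE.
  have st : s <= s' := ss'.
  have rle : r <= rho / 4 by rewrite ler_pdivlMr//; have := mulr_ge0 C0 (ltW r0); lra.
  have Cr : C * r <= rho / 4 by rewrite ler_pdivlMr//; have := ltW r0; lra.
  (* On one step the affine function at the Euler velocity is below both [L] and [m], hence below
     their minimum; multiplying by [h k] gives the increments. *)
  have inc i : (grid_idx k s <= i < grid_idx k s')%N ->
      ((M + a) * (i.+1%:R * h k) + dotv b (X k i.+1)) - ((M + a) * (i%:R * h k) + dotv b (X k i))
      <= tcost k m i.+1 - tcost k m i.
    move=> /andP[Ii iJ]; have ih := grid_idx_h0 (ltnW iJ).
    have [t' [x' [t'T ht hx' LE]]] := LP ih.
    have [vC _] := VlP k i.
    have {}ht := lt_trans ht hk; have {}hx' := lt_trans hx' hk.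
    have /andP[i1 i2] := grid_idx_itv k s; have /andP[j1 j2] := grid_idx_itv k s'; have /andP[k1 k2] := grid_idx_itv k t.
    rewrite cs in i1 i2; rewrite cs' in j1 j2; rewrite ct in k1 k2.
    have q1 : (grid_idx k s)%:R * h k <= i%:R * h k by rewrite ler_pM2r// ler_nat.
    have q2 : i%:R * h k <= (grid_idx k s')%:R * h k by rewrite ler_pM2r// ler_nat ltnW.
    have hxi : enorm (X k i - X k (grid_idx k t)) <= C * (r + h k).
      have [it|/ltnW ti] := leqP i (grid_idx k t).
        rewrite enorm_distC (le_trans (euler_lip k it))// ler_wpM2l//; lra.
      rewrite (le_trans (euler_lip k ti))// ler_wpM2l//; lra.
    have ht' : `|t' - t| < rho.
      move: ht; rewrite !ltr_distl => /andP[? ?]; apply/andP; split; lra.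
    have hxx : enorm (x' - x t) < rho.
      have := enorm_triangle (X k i) x' (x t); have := enorm_triangle (X k (grid_idx k t)) (X k i) (x t).
      rewrite mulrDr in hxi; lra.
    have := rhoP t' x' (V k i) t'T ht' hxx vC; rewrite LE lee_fin => le_l.
    have le_m : a + dotv b (V k i) <= m%:R.
      apply: le_trans abm; apply: lerD; first exact: ler_norm.
      apply: (le_trans (dotv_le _ _)); rewrite ler_wpM2l ?enorm_ge0//.
    have le_min_ : a + dotv b (V k i) <= Num.min (l k i) m%:R by rewrite le_min le_l.
    rewrite tcostS (XYS k i).1 dotvDr dotvZr -(natr1 i).
    have := ler_wpM2l (ltW (h_gt0 k)) le_min_; lra.
  have := @incr_le (fun i => (M + a) * (i%:R * h k) + dotv b (X k i)) (tcost k m) _ _ (grid_idx_le k st) inc.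
  have /andP[d1 d2] := grid_idx_diff k st; rewrite cs cs' in d1 d2.
  (* The nodes span [s' - s] up to an error [h k], which [e] absorbs. *)
  have key : (M + a) * (s' - s) - (M + a) * ((grid_idx k s')%:R * h k - (grid_idx k s)%:R * h k) <= `|M + a| * h k.
    rewrite -mulrBr; apply: (le_trans (ler_norm _)); rewrite normrM ler_wpM2l// ler_norml.
    by apply/andP; split; lra.
  rewrite dotvDr dotvNr /=; lra.
Qed.

End Limit.

(** * Calculus facts for the final verification *)

Section Assembly.
Context {R : realType} {N : nat}.

(** As the derivative exists, its sign can be read off difference quotients from the right. *)
Lemma derive_ge0_right (f : R -> R) t rho : 0 < rho -> derivable f t 1 ->
  (forall s, t <= s -> s < t + rho -> f t <= f s) -> 0 <= 'D_1 f t.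
Proof.
move=> rho0 df H.
have cf : (fun h => h^-1 *: (f (h *: 1 + t) - f t)) @ 0^' --> 'D_1 f t by exact: df.
apply/ler_addgt0Pr => e e0.
have /= [d d0 dP] : \forall h \near (0 : R)^', `|'D_1 f t - h^-1 *: (f (h *: 1 + t) - f t)| < e.
  by move/cvgrPdist_lt: cf; exact.
pose h := Num.min d rho / 2.
have mp : 0 < Num.min d rho by rewrite lt_min d0.
have hp : 0 < h by rewrite divr_gt0.
have hm : h < Num.min d rho by rewrite /h; lra.
have hd : h < d by apply: (lt_le_trans hm); rewrite ge_min lexx.
have hr : h < rho by apply: (lt_le_trans hm); rewrite ge_min lexx orbT.
have hb : ball (0 : R) d h by rewrite /ball /= sub0r normrN gtr0_norm.
have := dP h hb (lt0r_neq0 hp).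
have : 0 <= h^-1 *: (f (h *: 1 + t) - f t).
  rewrite /GRing.scale /= mulr1 mulr_ge0 ?invr_ge0 ?(ltW hp)// subr_ge0 H//; first lra.
  by rewrite addrC ltrD2l.
move=> q0; rewrite ltr_distl => /andP[q1 q2]; lra.
Qed.

Lemma is_derive_dotv (b : 'rV[R]_N) (x : R -> 'rV[R]_N) (t : R) : derivable x t 1 ->
  is_derive t 1 (fun s => dotv b (x s)) (dotv b ('D_1 x t)).
Proof.
move=> dx; have dxj := (derivable_mxP x t 1).1 dx.
have -> : (fun s => dotv b (x s)) = \sum_(i < N) (b 0 i \*: (fun s => x s 0 i)).
  by apply/funext => s; rewrite fct_sumE.
have d i : derivable (b 0 i \*: (fun s => x s 0 i)) t 1 by apply: derivableZ; exact: dxj.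
apply: DeriveDef; first by apply: derivable_sum.
rewrite derive_sum//; apply: eq_bigr => i _; rewrite deriveZ; last exact: dxj.
by rewrite derive_mx// mxE.
Qed.

(** Each term is at most [K * (e i - s i)] plus the increment of [W], where [N.+1 * c] bounds the
    Euclidean speed of [x]; both sums are made smaller than [eps / 2]. *)
Lemma abs_cont_lipschitz_add (a b c M : R) (x : R -> 'rV[R]_N) (u W : R -> R) :
  0 <= c -> 0 <= M -> (forall j, lipR c (fun t => x t 0 j)) ->
  (forall s t, s <= t -> `|u t - u s| <= M * (t - s) + `|W t - W s|) ->
  (forall eps : R, 0 < eps -> exists2 delta, 0 < delta &
    forall n (s e : 'I_n -> R), (forall i, s i <= e i) ->
      (forall i j, i != j -> e i <= s j \/ e j <= s i) ->
      \sum_(i < n) (e i - s i) < delta ->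
      \sum_(i < n) `|W (e i) - W (s i)| < eps) ->
  abs_cont_on a b x u.
Proof.
move=> c0 M0 lx uW acW eps eps0.
have e2 : 0 < eps / 2 by rewrite divr_gt0.
have [d1 d10 d1P] := acW _ e2.
pose K := N.+1%:R * c + M + 1.
have K0 : 0 < K by rewrite ltr_wpDl// addr_ge0// mulr_ge0.
exists (Num.min d1 (eps / 2 / K)); first by rewrite lt_min d10 divr_gt0.
move=> n s e se dis; rewrite lt_min => /andP[sd1 sd2].
have se' i : s i <= e i by have [_ []] := se i.
have Wb := d1P n s e se' dis sd1.
have bound i : Num.sqrt (dotv (x (e i) - x (s i)) (x (e i) - x (s i)) + (u (e i) - u (s i)) ^+ 2)
    <= K * (e i - s i) + `|W (e i) - W (s i)|.
  set d := e i - s i; have d0 : 0 <= d by rewrite subr_ge0.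
  have h1 : enorm (x (e i) - x (s i)) <= N.+1%:R * c * d.
    have cd0 : 0 <= c * d by rewrite mulr_ge0.
    rewrite -mulrA -(ler_pXn2r (n := 2))// ?nnegrE ?enorm_ge0 ?mulr_ge0// enorm_sqr.
    have h : dotv (x (e i) - x (s i)) (x (e i) - x (s i)) <= \sum_(j < N) (c * d) ^+ 2.
      apply: ler_sum => j _; rewrite !mxE -expr2 -real_normK ?num_real//.
      rewrite lerXn2r ?nnegrE//; have := lx j (s i) (e i).
      by rewrite (ger0_norm (_ : 0 <= e i - s i)).
    apply: (le_trans h); rewrite sumr_const card_ord -[leLHS]mulr_natl [leRHS]exprMn ler_wpM2r ?sqr_ge0//.
    by rewrite -natrX ler_nat (leq_trans (leqnSn N))// expnS expn1 leq_pmulr.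
  have h2 := uW _ _ (se' i); rewrite -/d in h2.
  apply: (@le_trans _ _ (enorm (x (e i) - x (s i)) + `|u (e i) - u (s i)|)).
    have p1 := enorm_ge0 (x (e i) - x (s i)); have p2 := normr_ge0 (u (e i) - u (s i)).
    have p0 : 0 <= dotv (x (e i) - x (s i)) (x (e i) - x (s i)) + (u (e i) - u (s i)) ^+ 2.
      by rewrite addr_ge0 ?dotv_ge0 ?sqr_ge0.
    rewrite -(ler_pXn2r (n := 2))// ?nnegrE ?sqrtr_ge0 ?addr_ge0// sqr_sqrtr//.
    rewrite -enorm_sqr -[X in _ + X <= _]real_normK ?num_real//; nra.
  rewrite /K; lra.
apply: (@le_lt_trans _ _ (\sum_(i < n) (K * (e i - s i) + `|W (e i) - W (s i)|))).
  by apply: ler_sum => i _.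
rewrite big_split /= -mulr_sumr.
move: sd2; rewrite ltr_pdivlMr//; set Z := \sum_(i < n) (e i - s i); lra.
Qed.

End Assembly.

(** * Construction of the solution and proof of the inclusion *)

Theorem theorem4p5 (R : realType) (N : nat) (T : R)
  (L : R -> 'rV[R]_N -> 'rV[R]_N -> \bar R) (U : R -> 'rV[R]_N -> \bar R) :
  L1 T L -> L2 T L -> L3 T L -> L4 T L ->
  proper2 T U -> lsc2 (Uext T U) ->
  (forall t x u nt nx nu, epi T U (t, x, u) -> t < T ->
     normal_cone (epi T U) (t, x, u) (nt, nx, nu) ->
     exists (tk : R^nat) (xk : nat -> 'rV[R]_N) (ak : R^nat) (vk : nat -> 'rV[R]_N),
       [/\ tk @ \oo --> t, xk @ \oo --> x, ak @ \oo --> 0,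
           (forall k, tk k \in `[0, T] /\ L (tk k) (xk k) (vk k) \is a fin_num) &
           (forall k, nt + dotv (vk k) nx - nu * fine (L (tk k) (xk k) (vk k)) <= ak k)]) ->
  forall t0 x0 u0, epi T U (t0, x0, u0) -> t0 < T ->
  exists T0 : R, t0 < T0 /\ T0 < T /\
    exists (x : R -> 'rV[R]_N) (u : R -> R),
      [/\ abs_cont_on t0 T0 x u,
          x t0 = x0 /\ u t0 = u0,
          {ae (@lebesgue_measure R), forall t, t \in `[t0, T0] ->
              [/\ derivable x t 1, derivable u t 1 &
                  Qset L t (x t) ('D_1 x t, 'D_1 u t)]} &
          forall t, t \in `[t0, T0] -> (U t (x t) <= (u t)%:E)%E].
Proof.
move=> l1 l2 l3 l4 pU lscU HN t0 x0 u0 K0 t0T.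
have t00 : 0 <= t0.
  move: (K0); rewrite /epi /= /Uext; case: ifPn => [|_]; last by rewrite leye_eq.
  by rewrite in_segE => /andP[].
have x02 : 0 <= enorm x0 + 2 by rewrite addr_ge0 ?enorm_ge0.
have [C C0 HC] := l4 _ x02.
have [M M0 HM] := L_bounded_below x02 C0 l1 l2.
(* The first bound puts [T0 = t0 + h0] before [T]; the second gives [C * h0 <= 1], which keeps the
   polygons within 1 of [x0]. *)
pose h0 := Num.min ((T - t0) / 2) (C + 1)^-1.
have h00 : 0 < h0 by rewrite lt_min divr_gt0 ?subr_gt0// invr_gt0 ltr_wpDl.
have h0T : t0 + h0 < T.
  have : h0 <= (T - t0) / 2 by rewrite ge_min lexx.
  lra.
have Ch0 : C * h0 <= 1.
  have C1 : 0 < C + 1 by rewrite ltr_wpDl.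
  have : h0 <= (C + 1)^-1 by rewrite ge_min lexx orbT.
  rewrite -(ler_pM2l C1) mulfV ?gt_eqF//; lra.
(* Chosen so that the accuracies [del k] are at most [1/2], satisfy [t0 + h0 + del k <= T], and tend
   to 0. *)
pose dm := Num.min (1/2) (T - t0 - h0).
have dm0 : 0 < dm by rewrite lt_min; apply/andP; split; lra.
have dm1 : dm <= 1/2 by rewrite ge_min lexx.
have dm2 : dm <= T - t0 - h0 by rewrite ge_min lexx orbT.
pose del k : R := dm * k.+1%:R^-1.
have k1 k : 0 < (k.+1%:R^-1 : R) <= 1 by rewrite invr_gt0 ltr0Sn invf_le1// ler1n.
have del0 k : 0 < del k <= 1/2.
  have /andP[a b] := k1 k; rewrite mulr_gt0//=; apply: le_trans dm1; by rewrite ger_pMr.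
have del1 k : del k <= dm by have /andP[a b] := k1 k; rewrite /del ger_pMr.
have del2 k : del k <= k.+1%:R^-1.
  by have /andP[a b] := k1 k; rewrite /del ger_pMl//; lra.
have del3 k : t0 + h0 + del k <= T by have := del1 k; lra.
have approx k := euler_approximation HN lscU K0 C0 M0 h00 Ch0 HC HM (del0 k) (del3 k) (ler0n R k).
have {approx} /choice[h /choice[X /choice[Y /choice[V /choice[l P]]]]] := approx.
have [F [FU ooF]] := ultra_oo.
have [||||||x [u [w [[xlip [xt0 ut0]] [wlip w0 wS wt0] wu Uu Hmin]]]] :=
  @euler_limit R N T L U t0 u0 h0 C M x0 C0 M0 h00 t00 (ltW h0T) lscU pU l1 h X Y V l _ _ _ _ _ _ F FU ooF.
- by move=> k; have [/andP[-> hd] _ _ _ _] := P k; rewrite (lt_le_trans hd).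
- by move=> k; have [] := P k.
- by move=> k; have [] := P k.
- by move=> k; have [] := P k.
- move=> k i ih; have [_ _ _ _ /(_ i ih)[[t' [x' [a b c d]]] _]] := P k.
  by exists t', x'; split => //; [exact: lt_le_trans b _|exact: lt_le_trans c _].
- move=> k i ih; have [_ _ _ _ /(_ i ih)[_ [v Kv hv]]] := P k.
  exists v => //; apply: (le_trans hv); have /andP[d0 _] := del0 k.
  by apply: le_trans (del2 k); lra.
have t0T0 : t0 < t0 + h0 by rewrite ltrDl.
have [|W [Wt0 Wle Wac Wae]] := @monotone_lipschitz_limit R w (fun m => M + m%:R)
  (fun t => M * (t - t0) + u0 - u t) t0 (t0 + h0) t0T0 _ wlip w0 wS wt0 wu.
  by move=> m; rewrite addr_ge0.
exists (t0 + h0); split => //; split => //.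
(* The value component is built from [W]: it is absolutely continuous and dominates the limit
   [u]. *)
pose ut t := u0 + M * (t - t0) - W t.
exists x, ut; split.
- apply: (@abs_cont_lipschitz_add R N t0 (t0 + h0) C M x ut W) => //.
  move=> s t st; rewrite /ut.
  have -> : u0 + M * (t - t0) - W t - (u0 + M * (s - t0) - W s) =
    M * (t - s) - (W t - W s) by ring.
  apply: (le_trans (ler_normB _ _)); rewrite lerD2r normrM !ger0_norm ?subr_ge0//.
- by split => //; rewrite /ut Wt0; ring.
- have ae_neq (c : R) : {ae (@lebesgue_measure R), forall t, t != c}.
    exists [set c]; split; [exact: measurable_set1|exact: lebesgue_measure_set1|].
    by move=> t /= /negP; rewrite negbK => /eqP.
  have ae_x : {ae (@lebesgue_measure R), forall t, forall j : 'I_N,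
      t0 < t < t0 + h0 -> derivable (fun t => x t 0 j) t 1}.
    apply: filter_forall => j; exact: (lipschitz_ae_derivable t0T0 C0 (xlip j)).
  (* The derivatives are controlled on the open interval only; its endpoints form a null set. *)
  have ae_end : {ae (@lebesgue_measure R), forall t, t != t0 /\ t != t0 + h0}.
    move: (ae_neq t0) (ae_neq (t0 + h0)); apply: filterS2.
    - exact: (ae_filter_ringOfSetsType (@lebesgue_measure R)).
    - by move=> t.
  move: Wae ae_x ae_end; apply: filterS3.
    exact: (ae_filter_ringOfSetsType (@lebesgue_measure R)).
  move=> t Wt xt [tn0 tn1]; rewrite in_segE => /andP[ta tb].
  have tt : t0 < t < t0 + h0 by rewrite !lt_neqAle eq_sym tn0 ta tn1 tb.
  have {Wt}[dW dw] := Wt tt.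
  have dx : derivable x t 1.
    by apply/derivable_mxP => i j; rewrite (ord1 i); exact: xt.
  have dut : is_derive t 1 ut (M - 'D_1 W t).
    have dW' : is_derive t 1 W ('D_1 W t) by apply: derivableP.
    have -> : ut = cst (u0 - M * t0) + M \*: id - W.
      by apply/funext => s; rewrite /ut !fctE /= -[M *: s]/(M * s); ring.
    apply: is_derive_eq; rewrite -[M *: 1]/(M * 1); ring.
  case: dut => dut dutE; split => //.
  (* By contradiction: an affine minorant of [L t (x t)] would exceed ['D_1 W t - M] at the velocity
     ['D_1 x t]. *)
  rewrite /Qset /= dutE opprB leNgt; apply/negP => rL.
  have tT : t \in `[0, T] by rewrite in_segE; apply/andP; split; lra.
  have [cvx _ dom] := l2 t (x t) tT.
  (* Constants for radius [enorm (x t)]: beyond [C'] the value is [+oo], so [- M'] bounds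
     [L t (x t)] below on the whole space. *)
  have [C' C'0 HC'] := l4 _ (enorm_ge0 (x t)).
  have [M' M'0 HM'] := L_bounded_below (enorm_ge0 (x t)) C'0 l1 l2.
  have ellM v : ((- M')%:E <= L t (x t) v)%E.
    have [vC|vC] := leP (enorm v) C'; first exact: HM'.
    by rewrite (HC' t (x t) v tT (lexx _) vC) leey.
  have lscL v (r : R) : (r%:E < L t (x t) v)%E -> exists2 d : R, 0 < d &
     forall v', enorm (v' - v) < d -> (r%:E < L t (x t) v')%E.
    move=> /(l1 t (x t) v r tT)[d d0 dP]; exists d => // v' hv.
    by apply: dP => //; rewrite subrr ?normr0 ?enorm0.
  have [a [b [abL rab]]] := affine_minorant lscL cvx ellM dom rL.
  pose m := (Num.truncn (`|a| + enorm b * C)).+1.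
  have abm : `|a| + enorm b * C <= m%:R by rewrite ltW// Num.Theory.truncnS_gt.
  have [rho rho0 rhoP] := Hmin t a b m tt abm (fun v _ => abL v).
  have [dwm wmW] := dw m.
  have dwm' : is_derive t 1 (w m) ('D_1 (w m) t) by apply: derivableP.
  have dbx := is_derive_dotv b dx.
  (* By [rhoP], [phi] stays above [phi t] just after [t]. Its derivative is thus nonnegative, that
     is [M + a + <b, x'> <= (w m)'], and [(w m)' <= W'] contradicts the choice of [a] and [b]. *)
  pose phi : R -> R := w m - (M + a) \*: id - (fun s => dotv b (x s)).
  have dphi : is_derive t 1 phi ('D_1 (w m) t - (M + a) - dotv b ('D_1 x t)).
    apply: is_derive_eq; rewrite -[(M + a) *: 1]/((M + a) * 1); ring.
  case: dphi => dphi dphiE.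
  have dphi0 : 0 <= 'D_1 phi t.
    apply: (derive_ge0_right rho0 dphi).
    move=> s ts sr; have := rhoP t s; rewrite ltrBlDr ltrDl => /(_ rho0 ts sr).
    rewrite /phi !fctE /= -[(M + a) *: t]/((M + a) * t) -[(M + a) *: s]/((M + a) * s).
    rewrite dotvDr dotvNr; lra.
  move: dphi0; rewrite dphiE; lra.
- move=> t; rewrite in_segE => tt; apply: (le_trans (Uu t tt)).
  rewrite lee_fin /ut; have := Wle t tt; lra.
Qed.
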